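(* Let $F:[0,\tau]\times L^2(\Omega)\to L^2(\Omega)$ satisfy: there exists $\kappa>0$ such that $\|F(s,\psi_1)-F(s,\psi_2)\|\le\kappa\|\psi_1-\psi_2\|$ for all $s\in[0,\tau]$ and $\psi_1,\psi_2\in L^2(\Omega)$; and there exists $\phi\in L^2(\Omega)$ such that $s\mapsto F(s,\phi)\in L^1(0,\tau;L^2(\Omega))$. Let $g\in L^2(\Omega)$ and let $u\in C([0,\tau];L^2(\Omega))$ be the unique solution of the final value problem $$u_t-\Delta u=F(t,u)+\int_t^\tau u(x,s)\,ds\ \text{ in }\Omega\times(0,\tau),\qquad u=0\ \text{ on }\partial\Omega\times(0,\tau),\qquad u(\cdot,\tau)=g\ \text{ in }\Omega.$$ For $\delta>0$ let $g^\delta\in L^2(\Omega)$ satisfy $\|g^\delta-g\|\le\delta$, and for $N\in\mathbb{N}$ let $u^N_\delta\in C([0,\tau];L^2(\Omega))$ be the unique element satisfying $$u^N_\delta(t)=\mathcal{S}_N(\tau-t)g^\delta-\int_t^\tau\mathcal{S}_N(s-t)F(s,u^N_\delta(s))\,ds-\int_t^\tau\mathcal{S}_N(s-t)\int_s^\tau u^N_\delta(\xi)\,d\xi\,ds,\qquad 0\le t\le\tau.$$ For $p,q,\varrho>0$ let $$\mathcal{K}_{p,\tau}=\{v\in C([0,\tau];L^2(\Omega)):\|v\|_{L^\infty(0,\tau;\mathbb{G}_{p,\tau})}\le\varrho\},\qquad \mathcal{M}_{0,q}=\{v\in C([0,\tau];L^2(\Omega)):\|v\|_{L^\infty(0,\tau;\mathbb{G}_{0,q+\tau})}\le\varrho\}.$$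 Let $e_1,e_2>0$ be such that $e_1n^{2/d}\le\lambda_n\le e_2n^{2/d}$ for all $n\in\mathbb{N}$. Let $\kappa_0=\max\{\kappa,1\}$, $\kappa_1=1+\kappa_0$, and $\eta(t)=e_1t+e_2(\tau-t)$ for $0\le t\le\tau$. For $r\in\mathbb{R}$ let $[[r]]$ denote the greatest integer not exceeding $r$. Then the following hold: (i) If $u\in\mathcal{K}_{p,\tau}$, then for each $t\in[0,\tau]$ there exists $\delta_t>0$ such that, for $0<\delta\le\delta_t$ and the choice $$N_\delta=\left[\left[\left(\ln\left(\left(\frac{\delta}{\varrho}\right)^{-1/\eta(t)}\left(\frac{1}{\eta(t)}\ln\frac{\varrho}{\delta}\right)^{-p/\eta(t)}\right)\right)^{d/2}\right]\right],$$ we have $$\|u(t)-u^{N_\delta}_\delta(t)\|=O\left(e^{\kappa_1(\tau-t)}\,\varrho^{e_2(\tau-t)/\eta(t)}\,\delta^{e_1t/\eta(t)}\left(\frac{1}{\eta(t)}\ln\frac{\varrho}{\delta}\right)^{-pe_2(\tau-t)/\eta(t)}\right),\qquad\delta\to0.$$ (ii) If $u\in\mathcal{M}_{0,q}$, then for each $t\in[0,\tau]$ and $$N_\delta=\left[\left[\left(\frac{1}{e_1(q+t)+e_2(\tau-t)}\ln\frac{\varrho}{\delta}\right)^{d/2}\right]\right],$$ we have $$\|u(t)-u^{N_\delta}_\delta(t)\|=O\left(e^{\kappa_1(\tau-t)}\,\varrho^{\frac{e_2(\tau-t)}{e_1(q+t)+e_2(\tau-t)}}\,\delta^{\frac{e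_1(q+t)}{e_1(q+t)+e_2(\tau-t)}}\right),\qquad\delta\to0.$$
   Context: $\Omega\subset\mathbb{R}^d$ ($d\ge1$) is a bounded domain with smooth boundary, $\tau>0$ is fixed; $\langle\cdot,\cdot\rangle$ and $\|\cdot\|$ are the inner product and norm of $L^2(\Omega)$. $0<\lambda_1\le\lambda_2\le\cdots\to\infty$ are the eigenvalues of the Dirichlet problem $-\Delta v=\lambda v$ in $\Omega$, $v=0$ on $\partial\Omega$, with eigenfunctions $\varphi_j\in H^1_0(\Omega)\cap H^2(\Omega)$ forming an orthonormal basis of $L^2(\Omega)$. It is known that constants $e_1,e_2>0$ with $e_1n^{2/d}\le\lambda_n\le e_2n^{2/d}$ for all $n\in\mathbb{N}$ exist. For $N\in\mathbb{N}$ and $t\in[0,\tau]$, $\mathcal{S}_N(t):L^2(\Omega)\to L^2(\Omega)$ is defined by $\mathcal{S}_N(t)\psi=\sum_{j=1}^N e^{\lambda_j t}\langle\psi,\varphi_j\rangle\varphi_j$. For $a,b\ge0$, the Gevrey space is $\mathbb{G}_{a,b}=\{\psi\in L^2(\Omega):\sum_{j=1}^\infty\lambda_j^{2a}e^{2b\lambda_j}|\langle\psi,\varphi_j\rangle|^2<\infty\}$, a Hilbert space with norm $\|\psi\|_{\mathbb{G}_{a,b}}^2=\sum_{j=1}^\infty\lambda_j^{2a}e^{2b\lambda_j}|\langle\psi,\varphi_j\rangle|^2$. $L^\infty(0,\tau;\mathbb{G}_{a,b})$ carries the usual essential supremum norm. Standing assumption: the final value problem has a unique solution $u\in C([0,\tau];L^2(\Omega))$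 for the exact final value $g$. Its coefficients $u_j(t)=\langle u(t),\varphi_j\rangle$ satisfy, for all $j\in\mathbb{N}$ and $t\in[0,\tau]$, $$u_j(t)=e^{\lambda_j(\tau-t)}\langle g,\varphi_j\rangle-\int_t^\tau e^{\lambda_j(s-t)}\langle F(s,u(s)),\varphi_j\rangle\,ds-\int_t^\tau e^{\lambda_j(s-t)}\int_s^\tau u_j(\xi)\,d\xi\,ds .$$ *)

(* Defs.v *)
From HB Require Import structures.
From mathcomp Require Import all_boot all_order all_algebra.
From mathcomp Require Import all_classical all_reals all_analysis.
From mathcomp Require Import ess_sup_inf lra.

Set Implicit Arguments.
Unset Strict Implicit.
Unset Printing Implicit Defensive.
Import Order.TTheory GRing.Theory Num.Theory.
Import numFieldNormedType.Exports.
Local Open Scope classical_set_scope.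
Local Open Scope ring_scope.

Section lebesgue_tuple_step.
Context {R : realType} (n : nat).
Notation RR := (measurableTypeR R).
Variable m : {sigma_finite_measure set (n.-tuple RR) -> \bar R}.

Definition cons_tuple (x : RR * n.-tuple RR) : n.+1.-tuple RR :=
  [tuple of x.1 :: x.2].

Lemma measurable_cons_tuple : measurable_fun [set: RR * n.-tuple RR] cons_tuple.
Proof. exact: measurable_cons. Qed.

Definition lebesgue_tupleS : set (n.+1.-tuple RR) -> \bar R :=
  pushforward (lebesgue_measure \x m)%E cons_tuple.

HB.instance Definition _ :=
  isMeasurableFun.Build _ _ _ _ cons_tuple measurable_cons_tuple.

Let lebesgue_tupleS0 : lebesgue_tupleS set0 = 0%E.
Proof. exact: measure0. Qed.

Let lebesgue_tupleS_ge0 A : (0 <= lebesgue_tupleS A)%E.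
Proof. exact: measure_ge0. Qed.

Let lebesgue_tupleS_sigma_additive : semi_sigma_additive lebesgue_tupleS.
Proof. exact: measure_semi_sigma_additive. Qed.

HB.instance Definition _ := isMeasure.Build _ _ _ lebesgue_tupleS
  lebesgue_tupleS0 lebesgue_tupleS_ge0 lebesgue_tupleS_sigma_additive.

Let lebesgue_tupleS_sigma_finite : sigma_finite setT lebesgue_tupleS.
Proof.
have /sigma_finiteP[F [TF ndF Foo]] := sigma_finiteT (@lebesgue_measure R).
have /sigma_finiteP[G [TG ndG Goo]] := sigma_finiteT m.
pose unc (t : n.+1.-tuple RR) : RR * n.-tuple RR :=
  (thead t, [tuple of behead t]).
have munc : measurable_fun [set: n.+1.-tuple RR] unc.
  by apply/measurable_fun_pair;
    [exact: measurable_tnth|exact: measurable_behead].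
have cK : cancel cons_tuple unc.
  by move=> [a t]; congr pair; exact: val_inj.
exists (fun k => unc @^-1` (F k `*` G k)).
  apply/esym/seteqP; split=> // t _.
  have [i _ Fi] : (\bigcup_i F i) (unc t).1 by rewrite -TF.
  have [j _ Gj] : (\bigcup_i G i) (unc t).2 by rewrite -TG.
  exists (maxn i j) => //; split.
  - by move: Fi; exact/subsetPset/ndF/leq_maxl.
  - by move: Gj; exact/subsetPset/ndG/leq_maxr.
move=> k; have [mF Fk] := Foo k; have [mG Gk] := Goo k; split.
  by rewrite -[X in measurable X]setTI; apply: munc => //; exact: measurableX.
rewrite /lebesgue_tupleS /pushforward -comp_preimage.
rewrite (_ : unc \o cons_tuple = id) ?preimage_id; last exact/funext.
by rewrite product_measure1E// lte_mul_pinfty// ge0_fin_numE.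
Qed.

HB.instance Definition _ := Measure_isSigmaFinite.Build _ _ _ lebesgue_tupleS
  lebesgue_tupleS_sigma_finite.

End lebesgue_tuple_step.

(* Lebesgue measure on R^n, on Borel sets; see [lebesgue_tuple_box]. *)
Fixpoint lebesgue_tuple {R : realType} (n : nat) :
    {sigma_finite_measure set (n.-tuple (measurableTypeR R)) -> \bar R} :=
  match n with
  | 0 => \d_([tuple] : 0.-tuple (measurableTypeR R))
  | k.+1 => lebesgue_tupleS (lebesgue_tuple k)
  end.

Lemma lebesgue_tuple_box (R : realType) (n : nat)
    (A : 'I_n -> set (measurableTypeR R)) :
  (forall i, measurable (A i)) ->
  lebesgue_tuple n [set x | forall i, A i (tnth x i)] =
    (\prod_(i < n) lebesgue_measure (A i))%E.
Proof.
elim: n A => [|n IHn] A mA.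
  by rewrite big_ord0 /= diracE mem_set// => -[].
rewrite big_ord_recl /= /lebesgue_tupleS /pushforward.
rewrite -IHn; last by move=> i; exact: mA.
rewrite -product_measure1E//; last first.
  rewrite (_ : [set x | _] = \bigcap_(i in [set: 'I_n])
      ((fun x => tnth x i) @^-1` A (lift ord0 i))).
    apply: fin_bigcap_measurable => // i _.
    by rewrite -[X in measurable X]setTI; exact: measurable_tnth.
  by apply/seteqP; split => x Ax i; [move=> _; exact: Ax|exact: (Ax i I)].
congr (_ _); apply/seteqP; split => -[a x] /=.
  move=> H; split; first by have := H ord0; rewrite tnth0.
  by move=> i; have := H (lift ord0 i); rewrite tnthS.
move=> [Aa Ax] i; have [j ->|->] := unliftP ord0 i; first by rewrite tnthS.
by rewrite tnth0.
Qed.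

Section borel_matrix.
Context {R : realType} (m n : nat).

HB.instance Definition _ := @isMeasurable.Build
  (sigma_display (@open 'M[R]_(m, n))) 'M[R]_(m, n) <<s open >>
  (@sigma_algebra0 _ setT open) (@sigma_algebraC _ open)
  (@sigma_algebra_bigcup _ setT open).

End borel_matrix.

Section lebesgue_rV.
Context {R : realType} (n : nat).
Notation RR := (measurableTypeR R).

Lemma open_measurable_mx m (U : set 'M[R]_(m, n)) : open U -> measurable U.
Proof. exact: sub_sigma_algebra. Qed.

Definition row_of_tuple (x : n.-tuple RR) : 'rV[R]_n := \row_i tnth x i.

Lemma measurable_row_of_tuple : measurable_fun setT row_of_tuple.
Proof.
apply: (@measurability _ _ _ _ _ _ (@open 'rV[R]_n)) => // _ [U oU <-].
rewrite setTI.
pose B (c : {ffun 'I_n -> rat} * nat) : set (n.-tuple RR) :=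
  \bigcap_(i in [set: 'I_n])
    [set x | ball (ratr (c.1 i) : R) (c.2.+1%:R^-1) (tnth x i)].
pose P (c : {ffun 'I_n -> rat} * nat) := B c `<=` row_of_tuple @^-1` U.
suff -> : row_of_tuple @^-1` U =
    \bigcup_c (if `[< P c >] then B c else set0).
  apply: countable_bigcupT_measurable => //= c.
  case: ifPn => // _; apply: fin_bigcap_measurable => // i _.
  have := @measurable_tnth _ RR n i.
  move=> /(_ measurableT (ball (ratr (c.1 i) : R) (c.2.+1%:R^-1))).
  rewrite setTI; apply; rewrite ball_itv; exact: measurable_itv.
apply/seteqP; split => [x Ux|x [c _]]; last first.
  by case: ifPn => // /asboolP Pc /Pc.
have /nbhs_ballP[e /= e0 xeU] : nbhs (row_of_tuple x) U.
  exact: open_nbhs_nbhs.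
pose k := Num.truncn (2 / e).
pose r : R := k.+1%:R^-1.
have r0 : 0 < r by rewrite invr_gt0.
have re : r < e / 2.
  rewrite -[e / 2]invrK ltf_pV2 ?posrE ?invr_gt0 ?divr_gt0//.
  by rewrite invf_div; exact: truncnS_gt.
have /choice[q qP] : forall i : 'I_n, exists q : rat,
    ball (ratr q : R) r (tnth x i).
  move=> i; pose a : R := tnth x i.
  have [|q] := @rat_in_itvoo R (a - r) (a + r); first by lra.
  rewrite in_itv/= => aqa; exists q; rewrite /ball/= -/a ltr_norml.
  by move: (ratr q : R) aqa => b; lra.
pose c : {ffun 'I_n -> rat} * nat := (finfun q, k).
have Bx : B c x by move=> i _; rewrite /= ffunE.
exists c => //.
suff Pc : P c by rewrite asboolT.
move=> y By; apply: xeU; split => // i j; rewrite !mxE.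
apply: le_ball (ball_triangle (ball_sym (Bx j I)) (By j I)) => /=.
by rewrite -[c.2.+1%:R^-1]/r; lra.
Qed.

Definition lebesgue_rV : set 'rV[R]_n -> \bar R :=
  pushforward (lebesgue_tuple n) row_of_tuple.

HB.instance Definition _ :=
  isMeasurableFun.Build _ _ _ _ row_of_tuple measurable_row_of_tuple.

Let lebesgue_rV0 : lebesgue_rV set0 = 0%E. Proof. exact: measure0. Qed.

Let lebesgue_rV_ge0 A : (0 <= lebesgue_rV A)%E. Proof. exact: measure_ge0. Qed.

Let lebesgue_rV_sigma_additive : semi_sigma_additive lebesgue_rV.
Proof. exact: measure_semi_sigma_additive. Qed.

HB.instance Definition _ := isMeasure.Build _ _ _ lebesgue_rV
  lebesgue_rV0 lebesgue_rV_ge0 lebesgue_rV_sigma_additive.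

Lemma lebesgue_rV_box (A : 'I_n -> set RR) : (forall i, measurable (A i)) ->
  lebesgue_rV [set x | forall i, A i (x ord0 i)] =
    (\prod_(i < n) lebesgue_measure (A i))%E.
Proof.
move=> mA; rewrite -(lebesgue_tuple_box mA) /lebesgue_rV /pushforward.
congr (lebesgue_tuple n _).
by apply/seteqP; split => x Ax i; have := Ax i; rewrite /= mxE.
Qed.

End lebesgue_rV.
Arguments lebesgue_rV {R}.

Section domains.
Context {R : realType} {d : nat}.
Implicit Types (f : 'rV[R]_d -> R) (Omega : set 'rV[R]_d).

Definition partial (i : 'I_d) f : 'rV[R]_d -> R :=
  fun x => 'D_(delta_mx ord0 i) f x.

Fixpoint Ck (k : nat) f : Prop :=
  continuous f /\
  if k is k'.+1 then
    forall i : 'I_d,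
      (forall x, derivable f x (delta_mx ord0 i)) /\ Ck k' (partial i f)
  else True.

Definition smooth f := forall k, Ck k f.

(* Near each boundary point, Omega is a strict sublevel set of a smooth
   function with nonzero gradient there. *)
Definition smooth_boundary Omega :=
  forall x, (closure Omega `\` Omega) x ->
    exists U r, [/\ open_nbhs x U, smooth r,
      exists i, partial i r x != 0 &
      forall y, U y -> (Omega y <-> r y < 0)].

Definition test_function Omega f :=
  [/\ smooth f, compact (closure [set x | f x != 0]) &
      closure [set x | f x != 0] `<=` Omega].

End domains.

Record smooth_domain (R : realType) (d : nat) := SmoothDomain {
  dom_set :> set 'rV[R]_d ;
  dom_nonempty : dom_set !=set0 ;
  dom_open : open dom_set ;
  dom_connected : connected dom_set ;
  dom_bounded : bounded_set dom_set ;
  dom_smooth_boundary : smooth_boundary dom_set }.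

Section L2.
Context {R : realType} {d : nat} (Omega : smooth_domain R d).

Definition dom_measure : set 'rV[R]_d -> \bar R :=
  mrestr (lebesgue_rV d) (open_measurable_mx (@dom_open _ _ Omega)).

HB.instance Definition _ := Measure.on dom_measure.

End L2.

(* Elements of [L2 Omega] are representatives, not classes: they are identified
   when [norm2] of their difference vanishes, and only their values on Omega
   matter. *)
Notation L2 Omega := (LfunType (dom_measure Omega) (lee1n 2)).

Section L2_structure.
Context {R : realType} {d : nat} {Omega : smooth_domain R d}.
Implicit Types (f g : L2 Omega).

Definition inner f g : R := \int[dom_measure Omega]_x (f x * g x).

Definition norm2 f : R := fine ('N[dom_measure Omega]_2%:E[EFin \o f])%E.

Definition L2_eq f g := norm2 (f - g) = 0.

Definition weak_partial (i : 'I_d) f (h : L2 Omega) :=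
  forall phi : 'rV[R]_d -> R, test_function Omega phi ->
    \int[dom_measure Omega]_x (f x * partial i phi x) =
    - \int[dom_measure Omega]_x (h x * phi x).

Definition H2 f := exists (D : 'I_d -> L2 Omega) (DD : 'I_d -> 'I_d -> L2 Omega),
  (forall i, weak_partial i f (D i)) /\
  (forall i j, weak_partial j (D i) (DD i j)).

(* H^1_0 is the closure of the test functions in H^1. *)
Definition H10 f := exists (D : 'I_d -> L2 Omega) (phi : nat -> 'rV[R]_d -> R),
  [/\ forall i, weak_partial i f (D i),
      forall n, test_function Omega (phi n),
      'N[dom_measure Omega]_2%:E[EFin \o (phi n \- f)%R]%E @[n --> \oo]
        --> 0%E &
      forall i,
        'N[dom_measure Omega]_2%:E[EFin \o (partial i (phi n) \- D i)%R]%E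
          @[n --> \oo] --> 0%E].

Definition is_laplacian f l :=
  exists (D DD : 'I_d -> L2 Omega),
    [/\ forall i, weak_partial i f (D i),
        forall i, weak_partial i (D i) (DD i) &
        L2_eq l (\sum_i DD i)].

(* [lam j] and [phi j] stand for lambda_(j+1) and phi_(j+1). *)
Definition dirichlet_eigenbasis (lam : nat -> R) (phi : nat -> L2 Omega) :=
  [/\ [/\ forall j, 0 < lam j,
          nondecreasing_seq lam &
          lam j @[j --> \oo] --> +oo],
      forall j, [/\ H10 (phi j), H2 (phi j) &
                    is_laplacian (phi j) (- lam j *: phi j)],
      forall i j, inner (phi i) (phi j) = (i == j)%:R &
      forall f : L2 Omega,
        norm2 (f - \sum_(j < n) inner f (phi j) *: phi j) @[n --> \oo] --> 0].

End L2_structure.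

Section bochner.
Context {R : realType} {d : nat} {Omega : smooth_domain R d}.
Implicit Types (v : R -> L2 Omega) (D : set R).

Definition step_fun (s : seq (set R * L2 Omega)) (x : R) : L2 Omega :=
  \sum_(A <- s) \1_(A.1) x *: A.2.

Definition step_int (s : seq (set R * L2 Omega)) : L2 Omega :=
  \sum_(A <- s) fine (lebesgue_measure A.1) *: A.2.

(* The almost everywhere convergence is strong measurability; it is needed
   because [\int] of a nonmeasurable function is only a lower integral. *)
Definition is_bochner_integral D v (I : L2 Omega) :=
  exists s : nat -> seq (set R * L2 Omega),
    [/\ forall n A, A \in s n ->
          [/\ measurable A.1, A.1 `<=` D & (lebesgue_measure A.1 < +oo)%E],
        {ae lebesgue_measure, forall x, D x ->
          norm2 (v x - step_fun (s n) x) @[n --> \oo] --> 0},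
        (\int[lebesgue_measure]_(x in D) (norm2 (v x - step_fun (s n) x))%:E)%E
          @[n --> \oo] --> 0%E &
        norm2 (I - step_int (s n)) @[n --> \oo] --> 0].

Definition bochner_integrable D v := exists I, is_bochner_integral D v I.

Definition bochner_integral D v : L2 Omega :=
  xget 0 [set I | is_bochner_integral D v I].

Definition continuous_L2 (tau : R) v :=
  forall t, t \in `[0, tau] ->
    norm2 (v s - v t) @[s --> within `[0, tau] (nbhs t)] --> 0.

(* [u] belongs to C([0, tau]; L^2) and is its only element satisfying [P]. *)
Definition unique_in_C (tau : R) (P : (R -> L2 Omega) -> Prop) u :=
  [/\ continuous_L2 tau u, P u &
      forall v, continuous_L2 tau v -> P v ->
        forall t, t \in `[0, tau] -> L2_eq (v t) (u t)].

End bochner.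

Section problem.
Context {R : realType} {d : nat} {Omega : smooth_domain R d}.
Variables (tau : R) (lam : nat -> R) (phi : nat -> L2 Omega).
Variables (F : R -> L2 Omega -> L2 Omega).
Implicit Types (g : L2 Omega) (u : R -> L2 Omega).

Definition S_trunc (N : nat) (t : R) (psi : L2 Omega) : L2 Omega :=
  \sum_(j < N) (expR (lam j * t) * inner psi (phi j)) *: phi j.

Definition gevrey_norm (a b : R) (psi : L2 Omega) : \bar R :=
  ((\sum_(0 <= j <oo) (lam j `^ (2 * a) * expR (2 * b * lam j) *
     `|inner psi (phi j)| ^+ 2)%:E) `^ 2^-1)%E.

Definition Linfty_gevrey_norm (a b : R) (v : R -> L2 Omega) : \bar R :=
  ess_sup (mrestr lebesgue_measure (measurable_itv `]0, tau[))
    (fun t => gevrey_norm a b (v t)).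

Definition calK (p rho : R) : set (R -> L2 Omega) :=
  [set v | continuous_L2 tau v /\ (Linfty_gevrey_norm p tau v <= rho%:E)%E].

Definition calM (q rho : R) : set (R -> L2 Omega) :=
  [set v | continuous_L2 tau v /\
           (Linfty_gevrey_norm 0 (q + tau) v <= rho%:E)%E].

(* Weak solutions of the final value problem: for w in the domain of the
   Dirichlet Laplacian, <u(.), w> is absolutely continuous with derivative
   <u, Delta w> + <F(t, u), w> + int_t^tau <u(xi), w>; integrated over
   [t, tau]. Both the equation and the boundary condition are encoded, as
   Delta is moved onto w without boundary term. *)
Definition final_value_solution g u :=
  [/\ L2_eq (u tau) g,
      bochner_integrable `[0, tau] (fun s => F s (u s)) &
      forall w l : L2 Omega, H10 w -> H2 w -> is_laplacian w l ->
      forall t, t \in `[0, tau] ->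
        inner g w - inner (u t) w =
        \int[lebesgue_measure]_(s in `[t, tau])
          (inner (u s) l + inner (F s (u s)) w +
           \int[lebesgue_measure]_(xi in `[s, tau]) inner (u xi) w)].

Definition coefficient_formula g u :=
  forall j t, t \in `[0, tau] ->
    inner (u t) (phi j) =
      expR (lam j * (tau - t)) * inner g (phi j)
      - \int[lebesgue_measure]_(s in `[t, tau])
          (expR (lam j * (s - t)) * inner (F s (u s)) (phi j))
      - \int[lebesgue_measure]_(s in `[t, tau])
          (expR (lam j * (s - t)) *
           \int[lebesgue_measure]_(xi in `[s, tau]) inner (u xi) (phi j)).

Definition regularized_solution (N : nat) g u :=
  forall t, t \in `[0, tau] ->
    bochner_integrable `[t, tau] (fun s => S_trunc N (s - t) (F s (u s))) /\
    L2_eq (u t)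
      (S_trunc N (tau - t) g
       - bochner_integral `[t, tau] (fun s => S_trunc N (s - t) (F s (u s)))
       - bochner_integral `[t, tau]
           (fun s => S_trunc N (s - t) (bochner_integral `[s, tau] u))).

End problem.

(* Main.v *)
Require Import Defs.
From mathcomp Require Import all_boot all_order all_algebra.
From mathcomp Require Import all_classical all_reals all_analysis.
From mathcomp Require Import finmap measurable_realfun simple_functions ess_sup_inf ring lra.
Import Order.TTheory GRing.Theory Num.Theory.
Import numFieldNormedType.Exports.
Local Open Scope classical_set_scope.
Local Open Scope ring_scope.

(* Let x = tau - t and let w be the difference of the projections of the
   regularized and the exact solution on the first N eigenfunctions; the
   regularized solution has no other component. Taking coefficients in both
   integral equations and testing with w itself bounds |w(t)| by
   e^((lambda_N + kappa_1) x) (delta + kappa r tau), where r bounds the norm of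
   the tail u - P_N u on [0, tau]: one evaluates the weighted norm
   e^(-(lambda_N + kappa_1) x) |w(t)| at its maximum. The Gevrey bound gives
   r <= rho lambda_(N+1)^(-a) e^(-b lambda_(N+1)), for almost every t and then
   for every t by continuity of the partial sums. If N is the integer part of
   X^(d/2), then lambda_N <= e2 X and e1 X <= lambda_(N+1), so both error terms
   are controlled by X, and the two choices of X balance them. *)

(** * The space L2 *)

Section L2_inner.
Set Implicit Arguments.
Unset Strict Implicit.
Context {R : realType} {d : nat} {Omega : smooth_domain R d}.
Implicit Types (f g h : L2 Omega) (a : R).
Local Notation mu := (dom_measure Omega).

(** [F] is only Lipschitz, so it couples all modes: the difference of the nonlinear terms is
    controlled by the whole of u - v, and the tail of u reenters the finite system as a source of
    size kappa r. The factor e^(lambda_N x) in front of it is harmless because the tail carries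
    e^(-b lambda_(N+1)) with b >= tau >= x. Balancing e^(e2 X x) delta against rho e^(-e1 (b - x) X)
    gives X = ln(rho/delta) / (e1 (b - x) + e2 x); for b = tau and b = q + tau the denominator is
    [eta t] and [zeta t]. In case (i) a logarithmic correction lowers this X so that both sides gain
    the same power of the logarithm. The other obstacle is the meaning of the integrals. [F s (u s)]
    is known only to be Bochner integrable, so its coefficients are measurable only off a null set;
    and [bochner_integral] defaults to 0, so the memory term of the regularized equation must be
    shown to exist. It does, because the regularized solution stays in the span of N
    eigenfunctions. *)

Lemma inner_integrable f g : mu.-integrable setT (EFin \o (fun x => f x * g x)).
Proof. by apply/Lfun1_integrable/Lfun2_mul_Lfun1; exact: LfunP. Qed.

Lemma innerC f g : inner f g = inner g f.
Proof. by apply: eq_Rintegral => x _; rewrite mulrC. Qed.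

Lemma innerDl f g h : inner (f + g) h = inner f h + inner g h.
Proof.
rewrite /inner -RintegralD//; try exact: inner_integrable.
by apply: eq_Rintegral => x _; rewrite -mulrDl.
Qed.

Lemma innerZl a f h : inner (a *: f) h = a * inner f h.
Proof.
rewrite /inner -RintegralZl//; last exact: inner_integrable.
by apply: eq_Rintegral => x _; rewrite mulrA.
Qed.

Lemma inner0l h : inner 0 h = 0.
Proof. by rewrite -(scale0r (0 : L2 Omega)) innerZl mul0r. Qed.

Lemma innerNl f h : inner (- f) h = - inner f h.
Proof. by rewrite -scaleN1r innerZl mulN1r. Qed.

Lemma innerBl f g h : inner (f - g) h = inner f h - inner g h.
Proof. by rewrite innerDl innerNl. Qed.

Lemma inner_suml I (r : seq I) (P : pred I) (F : I -> L2 Omega) h :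
  inner (\sum_(i <- r | P i) F i) h = \sum_(i <- r | P i) inner (F i) h.
Proof.
by apply: (big_morph (inner^~ h)) => [f g|]; rewrite ?inner0l ?innerDl.
Qed.

Lemma innerDr f g h : inner h (f + g) = inner h f + inner h g.
Proof. by rewrite innerC innerDl !(innerC h). Qed.

Lemma innerZr a f h : inner h (a *: f) = a * inner h f.
Proof. by rewrite innerC innerZl (innerC h). Qed.

Lemma innerBr f g h : inner h (f - g) = inner h f - inner h g.
Proof. by rewrite innerC innerBl !(innerC h). Qed.

Lemma inner_sumr I (r : seq I) (P : pred I) (F : I -> L2 Omega) h :
  inner h (\sum_(i <- r | P i) F i) = \sum_(i <- r | P i) inner h (F i).
Proof. by rewrite innerC inner_suml; apply: eq_bigr => i _; rewrite innerC. Qed.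

Lemma norm2_ge0 f : 0 <= norm2 f.
Proof. by rewrite /norm2 fine_ge0// Lnorm_ge0. Qed.

Lemma norm2E f : (norm2 f)%:E = ('N[mu]_2%:E[EFin \o f])%E.
Proof. by rewrite /norm2 finite_norm_fine. Qed.

Lemma norm2_sqr f : norm2 f ^+ 2 = inner f f.
Proof.
apply: EFin_inj; rewrite /inner /Rintegral fineK; last first.
  exact: integrable_fin_num (inner_integrable f f).
rewrite -powR_mulrn ?norm2_ge0// -poweR_EFin norm2E powR_Lnorm//.
apply: eq_integral => x _ /=.
by rewrite powR_mulrn// real_normK ?num_real// expr2.
Qed.

Lemma norm2D f g : norm2 (f + g) <= norm2 f + norm2 g.
Proof. exact: ler_LnormD. Qed.

Lemma norm2Z a f : norm2 (a *: f) = `|a| * norm2 f.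
Proof.
apply/eqP; rewrite -(@eqrXn2 _ 2) ?mulr_ge0 ?norm2_ge0//.
by rewrite exprMn !norm2_sqr innerZl innerZr real_normK ?num_real// mulrA expr2.
Qed.

Lemma norm2N f : norm2 (- f) = norm2 f.
Proof. by rewrite -scaleN1r norm2Z normrN1 mul1r. Qed.

Lemma norm2C f g : norm2 (f - g) = norm2 (g - f).
Proof. by rewrite -norm2N opprB. Qed.

Lemma norm2_0 : norm2 (0 : L2 Omega) = 0.
Proof. by rewrite -(scale0r (0 : L2 Omega)) norm2Z normr0 mul0r. Qed.

Lemma norm2_triangle h f g : norm2 (f - g) <= norm2 (f - h) + norm2 (h - g).
Proof. by rewrite -[f - g](subrKA h) norm2D. Qed.

Lemma norm2_sum I (r : seq I) (P : pred I) (F : I -> L2 Omega) :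
  norm2 (\sum_(i <- r | P i) F i) <= \sum_(i <- r | P i) norm2 (F i).
Proof.
elim/big_ind2 : _ => [|x1 x2 y1 y2 h1 h2|//]; first by rewrite norm2_0.
exact: le_trans (norm2D _ _) (lerD h1 h2).
Qed.

Lemma cauchy_schwarz f g : `|inner f g| <= norm2 f * norm2 g.
Proof.
rewrite -lee_fin EFinM !norm2E.
have := @hoelder _ _ _ mu f g 2 2; rewrite Lnorm1 => /(_ _ _ _ _ _).
move=> /(_ (@measurable_funPT _ _ _ _ f) (@measurable_funPT _ _ _ _ g)).
move=> H; apply: le_trans (H _ _ _) => //; last by lra.
rewrite /inner EFin_normr_Rintegral//; last exact: inner_integrable.
apply: le_abse_integral => //.
exact: measurable_int (inner_integrable f g).
Qed.

Lemma inner_cong f g h : norm2 (f - g) = 0 -> inner f h = inner g h.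
Proof.
move=> fg; apply/eqP; rewrite -subr_eq0 -innerBl -normr_le0.
by rewrite (le_trans (cauchy_schwarz _ _))// fg mul0r.
Qed.

Lemma inner_cvg (T : Type) (G : set_system T) {FG : Filter G} (v : T -> L2 Omega)
    f h : norm2 (f - v x) @[x --> G] --> 0 -> inner (v x) h @[x --> G] --> inner f h.
Proof.
move=> vf; apply/cvgrPdist_le => e e0.
(* The [+ 1] keeps the divisor positive when [norm2 h] vanishes. *)
have h0 : 0 < norm2 h + 1 by rewrite ltr_wpDl ?norm2_ge0.
have /cvgrPdist_le /(_ (e / (norm2 h + 1))) := vf.
rewrite divr_gt0// => /(_ isT); apply: filterS => x.
rewrite sub0r normrN ger0_norm ?norm2_ge0// => vx.
rewrite -innerBl (le_trans (cauchy_schwarz _ _))//.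
rewrite ler_pdivlMr// in vx; apply: le_trans vx.
by rewrite ler_wpM2l ?norm2_ge0// lerDl.
Qed.

Lemma norm2_sqrt f : norm2 f = Num.sqrt (inner f f).
Proof. by rewrite -norm2_sqr sqrtr_sqr ger0_norm// norm2_ge0. Qed.

Lemma norm2_eq0 f : (forall k, inner f k = 0) -> norm2 f = 0.
Proof. by move=> f0; apply/eqP; rewrite -sqrf_eq0 norm2_sqr f0. Qed.

End L2_inner.

(** * Lower integrals and Bochner integrals *)

Section ae_integrable.
Set Implicit Arguments.
Unset Strict Implicit.
Context {dT} {T : measurableType dT} {R : realType}.
Variable mu : {measure set T -> \bar R}.
Implicit Types (D N : set T) (f g : T -> R).
Local Open Scope ereal_scope.

Import HBNNSimple.

(* [f] need not be measurable: [\int] is then a lower integral, which still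
   does not see null sets. *)
Lemma integral_setD_null D N (f : T -> \bar R) :
  measurable N -> mu N = 0 ->
  \int[mu]_(x in D) f x = \int[mu]_(x in D `\` N) f x.
Proof.
move=> mN N0.
suff ge0 (g : T -> \bar R) : (forall x, 0 <= g x) ->
    \int[mu]_(x in D) g x = \int[mu]_(x in D `\` N) g x.
  by rewrite integralE [RHS]integralE; congr (_ - _); apply: ge0 => x;
    [exact: funepos_ge0|exact: funeneg_ge0].
move=> g0; rewrite integral_mkcond [RHS]integral_mkcond.
have gD0 E x : 0 <= (g \_ E) x by exact: erestrict_ge0.
rewrite !ge0_integralTE//; apply/eqP; rewrite eq_le; apply/andP; split.
  apply: ge_ereal_sup => _ [h /= hg <-]; apply: ereal_sup_ubound => /=.
  (* Cutting a simple function below [g] on [D] to the complement of [N] puts it below [g] on [D]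
     minus [N] and leaves its integral unchanged. *)
  exists (proj_nnsfun h (measurableC mN)) => [x|].
    rewrite -mrestrict; have := hg x; have := gD0 (D `\` N) x.
    by rewrite !patchE in_setD in_setC; do 2 case: (_ \in _).
  rewrite -!integralT_nnsfun.
  rewrite (@ge0_negligible_integral _ _ _ mu setT N (EFin \o h))//; last 2 first.
  - exact/measurable_EFinP.
  - by move=> x _; rewrite lee_fin.
  rewrite (@ge0_negligible_integral _ _ _ mu setT N)//; last 2 first.
  - exact/measurable_EFinP.
  - by move=> x _; rewrite lee_fin.
  apply: eq_integral => x; rewrite in_setD => /andP[_ Nx].
  by rewrite -mrestrict patchE in_setC Nx.
apply: ge_ereal_sup => _ [h /= hg <-]; apply: ereal_sup_ubound => /=.
exists h => // x; apply: le_trans (hg x) _; rewrite !patchE in_setD.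
by case: (x \in D); case: (x \in N).
Qed.

(* The scalar products of a strongly measurable function are only almost
   everywhere equal to Borel functions. *)
Definition ae_integrable D f :=
  exists N, [/\ measurable N, mu N = 0 & mu.-integrable (D `\` N) (EFin \o f)].

Lemma integrable_ae_integrable D f :
  mu.-integrable D (EFin \o f) -> ae_integrable D f.
Proof. by move=> fi; exists set0; rewrite measure0 setD0. Qed.

Local Close Scope ereal_scope.

Lemma Rintegral_setD_null D N f : measurable N -> mu N = 0%E ->
  \int[mu]_(x in D) f x = \int[mu]_(x in D `\` N) f x.
Proof. by move=> mN N0; rewrite /Rintegral (@integral_setD_null D N). Qed.

(** The union of the two exceptional sets serves both functions; off it the usual rules for
    integrable functions apply. *)
Lemma ae_integrable_common D f g : measurable D ->
  ae_integrable D f -> ae_integrable D g ->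
  exists N, [/\ measurable N, mu N = 0%E,
    mu.-integrable (D `\` N) (EFin \o f) & mu.-integrable (D `\` N) (EFin \o g)].
Proof.
move=> mD [N [mN N0 fi]] [N' [mN' N'0 gi]]; exists (N `|` N'); split.
- exact: measurableU.
- by rewrite measureU0.
- apply: integrableS fi; [exact: measurableD|by apply/measurableD/measurableU|].
  by apply: setDS; exact: subsetUl.
- apply: integrableS gi; [exact: measurableD|by apply/measurableD/measurableU|].
  by apply: setDS; exact: subsetUr.
Qed.

Lemma ae_integrableD D f g : measurable D ->
  ae_integrable D f -> ae_integrable D g -> ae_integrable D (fun x => f x + g x).
Proof.
move=> mD fi gi.
have [N [mN N0 {}fi {}gi]] := ae_integrable_common mD fi gi.
by exists N; split => //; exact: (integrableD (measurableD mD mN) fi gi).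
Qed.

Lemma ae_RintegralD D f g : measurable D ->
  ae_integrable D f -> ae_integrable D g ->
  \int[mu]_(x in D) (f x + g x) =
  \int[mu]_(x in D) f x + \int[mu]_(x in D) g x.
Proof.
move=> mD fi gi.
have [N [mN N0 {}fi {}gi]] := ae_integrable_common mD fi gi.
rewrite !(@Rintegral_setD_null D N)// RintegralD//; exact: measurableD.
Qed.

Lemma ae_integrableZl D f a : measurable D ->
  ae_integrable D f -> ae_integrable D (fun x => a * f x).
Proof.
move=> mD [N [mN N0 fi]]; exists N; split => //.
exact: (integrableZl (measurableD mD mN) a fi).
Qed.

Lemma ae_RintegralZl D f a : measurable D -> ae_integrable D f ->
  \int[mu]_(x in D) (a * f x) = a * \int[mu]_(x in D) f x.
Proof.
move=> mD [N [mN N0 fi]].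
by rewrite !(@Rintegral_setD_null D N)// RintegralZl//; exact: measurableD.
Qed.

Lemma ae_RintegralB D f g : measurable D ->
  ae_integrable D f -> ae_integrable D g ->
  \int[mu]_(x in D) (f x - g x) =
  \int[mu]_(x in D) f x - \int[mu]_(x in D) g x.
Proof.
move=> mD fi gi; rewrite -mulN1r -ae_RintegralZl// -ae_RintegralD//; last first.
  exact: ae_integrableZl.
by apply: eq_Rintegral => x _; rewrite mulN1r.
Qed.

Lemma ae_integrableB D f g : measurable D ->
  ae_integrable D f -> ae_integrable D g -> ae_integrable D (fun x => f x - g x).
Proof.
move=> mD fi gi; have := ae_integrableD mD fi (ae_integrableZl (-1) mD gi).
by under eq_fun do rewrite mulN1r.
Qed.

Lemma ae_integrable_sum D I (r : seq I) (F : I -> T -> R) : measurable D ->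
  (forall i, ae_integrable D (F i)) ->
  ae_integrable D (fun x => \sum_(i <- r) F i x).
Proof.
move=> mD Fi; elim: r => [|i r IH].
  under eq_fun do rewrite big_nil.
  by apply: integrable_ae_integrable; exact: integrable0.
under eq_fun do rewrite big_cons.
exact: ae_integrableD.
Qed.

Lemma ae_Rintegral_sum D I (r : seq I) (F : I -> T -> R) : measurable D ->
  (forall i, ae_integrable D (F i)) ->
  \int[mu]_(x in D) (\sum_(i <- r) F i x) =
  \sum_(i <- r) \int[mu]_(x in D) F i x.
Proof.
move=> mD Fi; elim: r => [|i r IH].
  under eq_Rintegral do rewrite big_nil.
  by rewrite big_nil /Rintegral integral0.
under eq_Rintegral do rewrite big_cons.
by rewrite ae_RintegralD// ?IH ?big_cons//; exact: ae_integrable_sum.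
Qed.

Lemma ae_integrableM D f g : measurable D -> measurable_fun D g ->
  [bounded g x | x in D] -> ae_integrable D f ->
  ae_integrable D (fun x => g x * f x).
Proof.
move=> mD mg bg [N [mN N0 fi]]; exists N; split => //.
have := @integrableMr _ _ _ mu (D `\` N) _ g (EFin \o f).
apply => //; first exact: measurableD.
- exact: measurable_funS mg.
- by case: bg => M [rM bM]; exists M; split => // y /bM h x [/h].
Qed.

Lemma ae_integrableS D E f : measurable D -> measurable E -> E `<=` D ->
  ae_integrable D f -> ae_integrable E f.
Proof.
move=> mD mE ED [N [mN N0 fi]]; exists N; split => //.
by apply: integrableS fi; [exact: measurableD|exact: measurableD|exact: setSD].
Qed.

Lemma le_ae_Rintegral D f g : measurable D -> ae_integrable D f ->
  ae_integrable D g -> (forall x, D x -> `|f x| <= g x) ->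
  `|\int[mu]_(x in D) f x| <= \int[mu]_(x in D) g x.
Proof.
move=> mD fi gi fg.
have [N [mN N0 {}fi {}gi]] := ae_integrable_common mD fi gi.
have mDN : measurable (D `\` N) by exact: measurableD.
rewrite !(@Rintegral_setD_null D N)//.
apply: le_trans (le_normr_Rintegral mDN fi) _.
apply: le_Rintegral => //; first exact: integrable_norm.
by move=> x [Dx _]; exact: fg.
Qed.

End ae_integrable.

(** * Pairing Bochner integrals with a fixed vector *)

Section bochner_inner.
Set Implicit Arguments.
Unset Strict Implicit.
Context {R : realType} {d : nat} {Omega : smooth_domain R d}.
Implicit Types (h : L2 Omega) (s : seq (set R * L2 Omega)) (D : set R).
Local Notation leb := (@lebesgue_measure R).
Local Notation mset := (fun A : set R * L2 Omega => measurable (A.1 : set (measurableTypeR R))).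

Lemma step_fun_nil x : step_fun [::] x = 0 :> L2 Omega.
Proof. by rewrite /step_fun big_nil. Qed.

Lemma step_fun_cons A s x : step_fun (A :: s) x = \1_(A.1) x *: A.2 + step_fun s x.
Proof. by rewrite /step_fun big_cons. Qed.

Lemma step_fun_cat s1 s2 x : step_fun (s1 ++ s2) x = step_fun s1 x + step_fun s2 x.
Proof. by rewrite /step_fun big_cat. Qed.

Lemma measurable_inner_step s h : (forall A, A \in s -> mset A) ->
  measurable_fun setT (fun x => inner (step_fun s x) h).
Proof.
elim: s => [|A s IH] ms.
  by under eq_fun do rewrite step_fun_nil; exact: measurable_cst.
under eq_fun do rewrite step_fun_cons innerDl innerZl.
apply: measurable_funD; last first.
  by apply: IH => B Bs; apply: ms; rewrite inE Bs orbT.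
apply: measurable_funM => //.
by apply: measurable_indic; apply: ms; rewrite inE eqxx.
Qed.

(** The squared norm expands, term by term of the list, into products of indicators and inner
    products of step functions with fixed vectors. *)
Lemma measurable_norm2_step s : (forall A, A \in s -> mset A) ->
  measurable_fun setT (fun x => norm2 (step_fun s x)).
Proof.
move=> ms; under eq_fun do rewrite norm2_sqrt.
apply: (@measurableT_comp _ _ _ _ _ _ (@Num.sqrt R)).
  by apply: continuous_measurable_fun; exact: sqrt_continuous.
elim: s ms => [|A s IH] ms.
  by under eq_fun do rewrite step_fun_nil; exact: measurable_cst.
have mA : measurable_fun setT (\1_(A.1) : measurableTypeR R -> R).
  by apply: measurable_indic; apply: ms; rewrite inE eqxx.
have {}ms B : B \in s -> mset B by move=> Bs; apply: ms; rewrite inE Bs orbT.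
under eq_fun do rewrite step_fun_cons innerDl !innerDr !innerZl !innerZr.
apply: measurable_funD; apply: measurable_funD.
- by do 2 (apply: measurable_funM => //).
- apply: measurable_funM => //.
  by under eq_fun do rewrite innerC; exact: measurable_inner_step.
- by apply: measurable_funM => //; exact: measurable_inner_step.
- exact: IH.
Qed.

Lemma integral_inner_step D s h : measurable (D : set (measurableTypeR R)) ->
  (forall A, A \in s -> [/\ mset A, A.1 `<=` D & (leb A.1 < +oo)%E]) ->
  leb.-integrable D (EFin \o (fun x => inner (step_fun s x) h)) /\
  \int[leb]_(x in D) inner (step_fun s x) h = inner (step_int s) h.
Proof.
move=> mD; elim: s => [|A s IH] ms.
  rewrite /step_int big_nil inner0l.
  under eq_Rintegral do rewrite step_fun_nil inner0l.
  under eq_fun do rewrite step_fun_nil inner0l.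
  by split; [exact: integrable0|rewrite /Rintegral integral0].
have [mA AD Afin] : [/\ mset A, A.1 `<=` D & (leb A.1 < +oo)%E].
  by apply: ms; rewrite inE eqxx.
have [|is_ IHs] := IH.
  by move=> B Bs; apply: ms; rewrite inE Bs orbT.
have iA : leb.-integrable D (EFin \o (\1_(A.1) : R -> R)).
  apply/integrableP; split.
    by apply/measurable_EFinP; exact: measurable_indic.
  under eq_integral do rewrite /= ger0_norm//.
  by rewrite integral_indic// setIidl.
have iAh : leb.-integrable D (EFin \o (fun x => \1_(A.1) x * inner A.2 h)).
  exact: (integrableZr mD (inner A.2 h) iA).
under eq_fun do rewrite step_fun_cons innerDl innerZl.
split; first exact: (integrableD mD iAh is_).
rewrite RintegralD// IHs RintegralZr// /step_int big_cons innerDl innerZl.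
by congr (_ * _ + _); rewrite /Rintegral integral_indic// setIidl.
Qed.

(** By Cauchy-Schwarz, L1 convergence of the step functions to [v] passes to their inner products
    with [h], while the step integrals converge to [I]; both limits of [inner (step_int (s n)) h]
    must agree. *)
Lemma bochner_inner D v (I : L2 Omega) h :
  measurable (D : set (measurableTypeR R)) -> is_bochner_integral D v I ->
  ae_integrable leb D (fun x => inner (v x) h) /\
  inner I h = \int[leb]_(x in D) inner (v x) h.
Proof.
move=> mD [s [ms [N [mN N0 aeN]] cvg1 cvg2]].
have msm n A : A \in s n -> mset A by move=> /ms[].
(* Everything happens off the null set where the step functions may fail to converge: there the
   inner products are pointwise limits of measurable functions. *)
pose D' := D `\` N.
have mD' : measurable (D' : set (measurableTypeR R)) by exact: measurableD.
have cvD' x : D' x -> norm2 (v x - step_fun (s n) x) @[n --> \oo] --> 0.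
  move=> [Dx Nx]; apply: contrapT => /= H.
  by apply: Nx; apply: aeN => /= /(_ Dx).
have minner : measurable_fun (D' : set (measurableTypeR R)) (fun x => inner (v x) h).
  apply: (@measurable_fun_cvg _ _ _ _ (fun n x => inner (step_fun (s n) x) h)).
    move=> n; apply: (@measurable_funS _ _ _ _ setT) => //.
    by apply: measurable_inner_step; exact: msm.
  by move=> x /cvD'; exact: inner_cvg.
(* This norm is a limit in [m] of norms of differences of two step functions; such a difference is
   the step function of the list [s m] followed by [s n] with negated values. *)
have mnorm n : measurable_fun (D' : set (measurableTypeR R))
    (fun x => norm2 (v x - step_fun (s n) x)).
  pose S m x := norm2 (step_fun (s m) x - step_fun (s n) x).
  apply: (@measurable_fun_cvg _ _ _ _ S).
    move=> m; apply: (@measurable_funS _ _ _ _ setT) => //.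
    pose s' := s m ++ [seq (A.1, - A.2) | A <- s n].
    suff -> : S m = fun x => norm2 (step_fun s' x).
      apply: measurable_norm2_step => A; rewrite mem_cat => /orP[/msm//|].
      by move=> /mapP[B /msm mB ->].
    apply/funext => x; rewrite /S /s' step_fun_cat; congr norm2; congr (_ + _).
    rewrite /step_fun big_map raddf_sum/=; apply: eq_bigr => A _.
    by rewrite scalerN.
  move=> x D'x; apply/cvgrPdist_le => e e0.
  have := cvD' x D'x => /cvgrPdist_le /(_ e e0); apply: filterS => m.
  rewrite sub0r normrN ger0_norm ?norm2_ge0//; apply: le_trans.
  rewrite ler_distl /S.
  have := norm2_triangle (step_fun (s m) x) (v x) (step_fun (s n) x).
  have := norm2_triangle (v x) (step_fun (s m) x) (step_fun (s n) x).
  rewrite (norm2C _ (v x)); lra.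
pose e n := (\int[leb]_(x in D') (norm2 (v x - step_fun (s n) x))%:E)%E.
have ecvg : e n @[n --> \oo] --> 0%E.
  suff -> : e = (fun n =>
      \int[leb]_(x in D) (norm2 (v x - step_fun (s n) x))%:E)%E by [].
  by apply/funext => n; exact/esym/(integral_setD_null _ _ mN N0).
have e0 n : (0 <= e n)%E by apply: integral_ge0 => x _; rewrite lee_fin norm2_ge0.
have /fine_cvgP[efin ecvgr] := ecvg.
have ims n : leb.-integrable D (EFin \o (fun x => inner (step_fun (s n) x) h)).
  by have [] := integral_inner_step h mD (ms n).
have ims' n : leb.-integrable D' (EFin \o (fun x => inner (step_fun (s n) x) h)).
  by apply: (integrableS mD mD' _ (ims n)) => x [].
have inorm n : e n \is a fin_num ->
    leb.-integrable D' (EFin \o (fun x => norm2 (v x - step_fun (s n) x))).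
  move=> fn; apply/integrableP; split; first exact/measurable_EFinP.
  under eq_integral do rewrite /= ger0_norm ?norm2_ge0//.
  by rewrite -ge0_fin_numE ?e0.
have inner_bound n x : `|inner (v x) h - inner (step_fun (s n) x) h| <=
    norm2 h * norm2 (v x - step_fun (s n) x).
  by rewrite -innerBl mulrC cauchy_schwarz.
(* A single step function at finite L1 distance from [v] already yields an integrable majorant. *)
have iv : leb.-integrable D' (EFin \o (fun x => inner (v x) h)).
  have [n _ /(_ n (leqnn n)) /= fn] := efin.
  have i1 : leb.-integrable D'
      (EFin \o (fun x => norm2 h * norm2 (v x - step_fun (s n) x))).
    exact: (integrableZl mD' (norm2 h) (inorm n fn)).
  have i2 := integrableD mD' (integrable_norm (ims' n)) i1.
  apply: le_integrable i2 => //; first exact/measurable_EFinP.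
  move=> x D'x /=; rewrite lee_fin [leRHS]ger0_norm; last first.
    by rewrite addr_ge0// mulr_ge0// norm2_ge0.
  rewrite -lerBlDl (le_trans _ (inner_bound n x))// (le_trans _ (lerB_dist _ _))//.
split; first by exists N.
have Dst n : \int[leb]_(x in D') inner (step_fun (s n) x) h = inner (step_int (s n)) h.
  by rewrite -(integral_inner_step h mD (ms n)).2 [RHS](@Rintegral_setD_null _ _ _ leb D N).
rewrite (@Rintegral_setD_null _ _ _ leb D N)// -/D'.
have l1 : inner (step_int (s n)) h @[n --> \oo] --> inner I h.
  exact: inner_cvg cvg2.
have l2 : inner (step_int (s n)) h @[n --> \oo] --> \int[leb]_(x in D') inner (v x) h.
  apply/cvgrPdist_le => ep ep0.
  have h0 : 0 < norm2 h + 1 by rewrite ltr_wpDl ?norm2_ge0.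
  have := ecvgr => /cvgrPdist_le /(_ (ep / (norm2 h + 1))).
  rewrite divr_gt0// => /(_ isT); apply: filterS2 efin => n fn.
  rewrite sub0r normrN ger0_norm ?fine_ge0// => hn.
  rewrite -Dst -RintegralB//.
  have iB : leb.-integrable D'
      (EFin \o (fun x => inner (v x) h - inner (step_fun (s n) x) h)).
    exact: (integrableB mD' iv (ims' n)).
  apply: le_trans (le_normr_Rintegral mD' iB) _.
  apply: (@le_trans _ _ (norm2 h * fine (e n))); last first.
    rewrite ler_pdivlMr// in hn; apply: le_trans hn; rewrite mulrC /=.
    by rewrite ler_wpM2l ?fine_ge0// lerDl.
  rewrite -[fine (e n)]/(\int[leb]_(x in D') (norm2 (v x - step_fun (s n) x))).
  rewrite -RintegralZl//; last exact: inorm.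
  apply: le_Rintegral => //; first exact: integrable_norm.
  exact: (integrableZl mD' (norm2 h) (inorm n fn)).
exact: (cvg_unique _ l1 l2).
Qed.

End bochner_inner.

(** * Bochner integrals of functions with finite-dimensional values *)

Section bochner_finite.
Set Implicit Arguments.
Unset Strict Implicit.
Context {R : realType} {d : nat} {Omega : smooth_domain R d}.
Local Notation leb := (@lebesgue_measure R).

(** A simple function below [f] is below [g], so monotonicity extends to lower integrals;
    [bochner_finite] applies it to the norm of [v x - step_fun (s n) x]. *)
Lemma ge0_le_lower_integral dT (T : measurableType dT)
    (mu : {measure set T -> \bar R}) (D : set T) (f g : T -> \bar R) :
  (forall x, D x -> 0 <= f x)%E -> (forall x, D x -> f x <= g x)%E ->
  (\int[mu]_(x in D) f x <= \int[mu]_(x in D) g x)%E.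
Proof.
move=> f0 fg; have g0 x : D x -> (0 <= g x)%E.
  by move=> Dx; exact: le_trans (f0 _ Dx) (fg _ Dx).
rewrite !ge0_integralE//; apply: ge_ereal_sup => _ [h /= hf <-].
apply: ereal_sup_ubound => /=; exists h => // x; apply: le_trans (hf x) _.
by rewrite !patchE; case: ifPn => // /set_mem /fg.
Qed.

Lemma cvg_sumr (T : Type) (F : set_system T) {FF : Filter F} (I : Type)
    (r : seq I) (f : I -> T -> R) (l : I -> R) :
  (forall i, f i @ F --> l i) ->
  \sum_(i <- r) f i x @[x --> F] --> \sum_(i <- r) l i.
Proof.
move=> fl; elim: r => [|i r IH].
  by under eq_fun do rewrite big_nil; rewrite big_nil; exact: cvg_cst.
by under eq_fun do rewrite big_cons; rewrite big_cons; exact: cvgD.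
Qed.

Import HBSimple.

(** Decomposition of [g] over its level sets; these are intersected with [D] because the sets of an
    approximating step function must lie in [D]. *)
Lemma sfun_step (g : {sfun measurableTypeR R >-> R}) (D : set R) (h : L2 Omega) x :
  D x -> step_fun
    [seq (g @^-1` [set y] `&` D, y *: h) | y <- fset_set (range g)] x = g x *: h.
Proof.
move=> Dx; rewrite /step_fun big_map [in RHS]fimfunE fsbig_finite//=.
rewrite scaler_suml; apply: eq_bigr => y _; rewrite scalerA; congr (_ *: _).
by rewrite mulrC indicI /= [in X in _ * (_ * X)]indicE mem_set// mulr1.
Qed.

(* Finite-dimensional values make completeness of L2 unnecessary. *)
Lemma bochner_finite (N : nat) (a : 'I_N -> R -> R) (h : 'I_N -> L2 Omega)
    (v : R -> L2 Omega) (D : set R) :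
  measurable (D : set (measurableTypeR R)) -> (leb D < +oo)%E ->
  (forall i, leb.-integrable D (EFin \o a i)) ->
  (forall x, D x -> norm2 (v x - \sum_(i < N) a i x *: h i) = 0) ->
  is_bochner_integral D v (\sum_(i < N) (\int[leb]_(x in D) a i x) *: h i).
Proof.
move=> mD Dfin ai va.
have /choice[g gP] : forall i, exists g : {sfun measurableTypeR R >-> R}^nat,
    [/\ forall n, leb.-integrable D (EFin \o g n),
        forall x, D x -> (EFin \o (g^~ x)) @ \oo --> (EFin \o a i) x &
        (fun n => \int[leb]_(z in D) `|(EFin \o a i) z - (g n z)%:E|)%E @ \oo --> 0%E].
  by move=> i; exact: approximation_sfun_integrable.
pose st i n := [seq (g i n @^-1` [set y] `&` D, y *: h i) | y <- fset_set (range (g i n))].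
pose s n := flatten [seq st i n | i <- enum 'I_N].
have mst i n A : A \in st i n ->
    [/\ measurable (A.1 : set (measurableTypeR R)), A.1 `<=` D & (leb A.1 < +oo)%E].
  move=> /mapP[y _ ->] /=; have mA : measurable (g i n @^-1` [set y] `&` D).
    exact: measurableI.
  split => //; apply: le_lt_trans Dfin; apply: le_measure => //; exact: mem_set.
have ms n A : A \in s n ->
    [/\ measurable (A.1 : set (measurableTypeR R)), A.1 `<=` D & (leb A.1 < +oo)%E].
  by move=> /flattenP[_ /mapP[i _ ->]]; exact: mst.
have sfE n x : D x -> step_fun (s n) x = \sum_(i < N) g i n x *: h i.
  move=> Dx; rewrite /step_fun big_flatten big_map big_enum /=.
  by apply: eq_bigr => i _; exact: sfun_step.
have gi i n : leb.-integrable D (EFin \o g i n) by have [] := gP i.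
(* Both vectors have the same inner product with every [k], by [integral_inner_step], so their
   difference has norm 0. *)
have siE n : norm2 (step_int (s n) - \sum_(i < N) (\int[leb]_(x in D) g i n x) *: h i) = 0.
  apply: norm2_eq0 => k; rewrite innerBl -(integral_inner_step k mD (ms n)).2.
  rewrite inner_suml; apply/eqP; rewrite subr_eq0; apply/eqP.
  under eq_Rintegral => x /set_mem Dx.
    rewrite sfE// inner_suml; under eq_bigr do rewrite innerZl mulrC; over.
  rewrite /= ae_Rintegral_sum//=; last first.
    move=> i; apply: ae_integrableZl => //; exact: integrable_ae_integrable.
  apply: eq_bigr => i _; rewrite ae_RintegralZl//; last exact: integrable_ae_integrable.
  by rewrite innerZl mulrC.
pose e i n := (\int[leb]_(z in D) `|(EFin \o a i) z - (g i n z)%:E|)%E.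
have ecvg i : e i n @[n --> \oo] --> 0%E by have [] := gP i.
have iag i n : leb.-integrable D (EFin \o (fun z => a i z - g i n z)).
  exact: (integrableB mD (ai i) (gi i n)).
have ecvgr i : fine (e i n) @[n --> \oo] --> 0.
  exact: (fine_cvg (ecvg i)).
have bound n x : D x -> norm2 (v x - step_fun (s n) x) <=
    \sum_(i < N) norm2 (h i) * `|a i x - g i n x|.
  move=> Dx; apply: le_trans (norm2_triangle (\sum_(i < N) a i x *: h i) _ _) _.
  rewrite va// add0r sfE// -sumrB; apply: le_trans (norm2_sum _ _ _) _.
  by apply: ler_sum => i _; rewrite -scalerBl norm2Z mulrC.
have sume n : (\sum_(i < N) (norm2 (h i))%:E * e i n)%E =
    (\int[leb]_(x in D) (\sum_(i < N) norm2 (h i) * `|a i x - g i n x|)%:E)%E.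
  under [RHS]eq_integral do rewrite -sumEFin.
  have inti i : leb.-integrable D (EFin \o (Num.norm \o (fun z => a i z - g i n z))).
    exact: integrable_norm.
  rewrite integral_sum//; last first.
    move=> i; exact: (integrableZl mD (norm2 (h i)) (inti i)).
  apply: eq_bigr => i _; under [RHS]eq_integral do rewrite EFinM.
  by rewrite integralZl//; exact: inti.
have cvgsum : (\sum_(i < N) (norm2 (h i))%:E * e i n)%E @[n --> \oo] --> 0%E.
  rewrite -[X in _ --> X](_ : (\sum_(i < N) (norm2 (h i))%:E * 0)%E = 0%E); last first.
    by rewrite big1// => i _; rewrite mule0.
  apply: cvg_nnesum => [i _|i _]; last exact: cvgeZl.
  by apply: nearW => n; rewrite mule_ge0 ?lee_fin ?norm2_ge0// integral_ge0.
exists s; split => //.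
- apply: aeW => x Dx; apply: (@squeeze_cvgr _ _ _ _ (cst 0)
      (fun n => \sum_(i < N) norm2 (h i) * `|a i x - g i n x|)).
  + by apply: nearW => n; rewrite norm2_ge0 bound.
  + exact: cvg_cst.
  + rewrite -[X in _ --> X](_ : \sum_(i < N) norm2 (h i) * `|a i x - a i x| = 0); last first.
      by rewrite big1// => i _; rewrite subrr normr0 mulr0.
    apply: cvg_sumr => i; apply: cvgM; first exact: cvg_cst.
    apply: cvg_norm; apply: cvgB.
      exact: cvg_cst.
    by have [_ /(_ x Dx)/fine_cvg] := gP i.
- apply: (squeeze_cvge (f := cst 0%E) (h := fun n => (\sum_(i < N) (norm2 (h i))%:E * e i n)%E)) => //.
    apply: nearW => n; rewrite integral_ge0//=; last by move=> x _; rewrite lee_fin norm2_ge0.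
    rewrite sume ge0_le_lower_integral// => x Dx; rewrite lee_fin ?norm2_ge0//; exact: bound.
  exact: cvg_cst.
- apply: (@squeeze_cvgr _ _ _ _ (cst 0)
      (fun n => \sum_(i < N) norm2 (h i) * fine (e i n))).
  + apply: nearW => n; rewrite norm2_ge0/=.
    apply: le_trans (norm2_triangle (\sum_(i < N) (\int[leb]_(x in D) g i n x) *: h i) _ _) _.
    rewrite (norm2C _ (step_int _)) siE addr0 -sumrB.
    apply: le_trans (norm2_sum _ _ _) _.
    apply: ler_sum => i _; rewrite -scalerBl norm2Z mulrC ler_wpM2l ?norm2_ge0//.
    rewrite -RintegralB//; exact: (le_normr_Rintegral mD (iag i n)).
  + exact: cvg_cst.
  + rewrite -[X in _ --> X](_ : \sum_(i < N) norm2 (h i) * 0 = 0); last first.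
      by rewrite big1// => i _; rewrite mulr0.
    by apply: cvg_sumr => i; apply: cvgM; [exact: cvg_cst|exact: ecvgr].
Qed.

End bochner_finite.

(** * A Gronwall estimate for Fourier coefficients *)

Section real_integrals.
Set Implicit Arguments.
Unset Strict Implicit.
Context {R : realType}.
Implicit Types (f g : R -> R) (a b c k tau : R) (A : set R).
Local Notation leb := (@lebesgue_measure R).

Lemma within_continuousM A f g :
  {within A, continuous f} -> {within A, continuous g} ->
  {within A, continuous (fun x => f x * g x)}.
Proof.
move=> /subspace_continuousP cf /subspace_continuousP cg.
by apply/subspace_continuousP => x Ax; apply: cvgM; [exact: cf|exact: cg].
Qed.

Lemma within_continuous_sum A I (r : seq I) (F : I -> R -> R) :
  (forall i, {within A, continuous (F i)}) ->
  {within A, continuous (fun x => \sum_(i <- r) F i x)}.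
Proof.
move=> cF; apply/subspace_continuousP => x Ax; apply: cvg_sumr => i.
by move/subspace_continuousP : (cF i); exact.
Qed.

Lemma continuous_exp_affine (k a : R) : continuous (fun s => expR (k * (s - a))).
Proof.
move=> s; apply: (@continuous_comp _ _ _ (fun s => k * (s - a)) expR).
  apply: cvgM; first exact: cvg_cst.
  by apply: cvgB; [exact: cvg_id|exact: cvg_cst].
exact: continuous_expR.
Qed.

Lemma continuous_itv_integrable f a b : {within `[a, b], continuous f} ->
  leb.-integrable `[a, b] (EFin \o f).
Proof. by apply: continuous_compact_integrable; exact: segment_compact. Qed.

Lemma within_subitv f a b c e : a <= c -> e <= b ->
  {within `[a, b], continuous f} -> {within `[c, e], continuous f}.
Proof.
move=> ac eb; apply: continuous_subspaceW; apply: subset_itv;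
by rewrite bnd_simp.
Qed.

Lemma lebesgue_itv_lty a b : (leb `[a, b] < +oo)%E.
Proof. exact/compact_finite_measure/segment_compact. Qed.

(** The tail is the full integral minus the integral from 0 to [s], which depends continuously on
    its upper end. *)
Lemma tail_integral_continuous tau f : 0 <= tau ->
  {within `[0, tau], continuous f} ->
  {within `[0, tau], continuous (fun s => \int[leb]_(x in `[s, tau]) f x)}.
Proof.
move=> tau0 cf; have fi := continuous_itv_integrable cf.
pose G s := \int[leb]_(x in `[0, tau]) f x - parameterized_integral leb 0 s f.
apply: (@subspace_eq_continuous _ _ _ G) => [s /set_mem /=|].
  rewrite in_itv/= => /andP[s0 st]; rewrite /G.
  rewrite /parameterized_integral Rintegral_itvB//.
  rewrite Rintegral_itv_obnd_cbnd//.
  by apply: integrableS fi => //; apply: subset_itvr; rewrite bnd_simp.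
have /subspace_continuousP cP := parameterized_integral_continuous tau0 fi.
by apply/subspace_continuousP => x Ax; apply: cvgB; [exact: cvg_cst|exact: cP].
Qed.

Lemma Rintegral_itv_cst a b c : a <= b -> \int[leb]_(x in `[a, b]) c = c * (b - a).
Proof.
move=> ab; rewrite Rintegral_cst//; congr (_ * _).
suff H : leb `[a, b] = (b - a)%:E by exact: (congr1 fine H).
rewrite lebesgue_measure_itv/= lte_fin -EFinB.
by case: ltgtP ab => // -> _; rewrite subrr.
Qed.

Lemma Rintegral_exp k a tau : 0 < k -> a <= tau ->
  \int[leb]_(s in `[a, tau]) expR (k * (tau - s)) = (expR (k * (tau - a)) - 1) / k.
Proof.
move=> k0; rewrite le_eqVlt => /predU1P[->|at_].
  by rewrite set_itv1 Rintegral_set1 subrr mulr0 expR0 subrr mul0r.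
pose P s : R := - k^-1 * expR (k * (tau - s)).
have cE : continuous (fun s : R => expR (k * (tau - s))).
  move=> s; have := @continuous_exp_affine (- k) tau s.
  by congr (_ _ _); apply/funext => x; rewrite mulNr -mulrN opprB.
have dP (s : R) : is_derive s 1 P (expR (k * (tau - s))).
  rewrite /P; apply: is_derive_eq.
  rewrite /GRing.scale /=.
  by field; rewrite gt_eqF.
rewrite /Rintegral (@continuous_FTC2 _ _ P)//.
- rewrite -EFinB/= /P subrr mulr0 expR0.
  by field; rewrite gt_eqF.
- exact: continuous_subspaceT.
- have cP : continuous P.
    by move=> s; apply: differentiable_continuous; apply/derivable1_diffP; have [] := dP s.
  split.
  + by move=> s _; have [] := dP s.
  + exact/cvg_at_right_filter/cP.
  + exact/cvg_at_left_filter/cP.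
- by move=> s _; rewrite derive1E; have [_ ->] := dP s.
Qed.

(** The vector A x - B c is A times the part of x orthogonal to c, and its squared length is A (A X
    - B^2). If A = 0, every [c j] vanishes. *)
Lemma sum_cauchy_schwarz N (c x : 'I_N -> R) :
  (\sum_(j < N) c j * x j) ^+ 2 <= (\sum_(j < N) c j ^+ 2) * \sum_(j < N) x j ^+ 2.
Proof.
set A := \sum_(j < N) c j ^+ 2; set B := \sum_(j < N) c j * x j.
set X := \sum_(j < N) x j ^+ 2.
have A0 : 0 <= A by apply: sumr_ge0 => j _; exact: sqr_ge0.
have : 0 <= \sum_(j < N) (A * x j - B * c j) ^+ 2.
  by apply: sumr_ge0 => j _; exact: sqr_ge0.
have -> : \sum_(j < N) (A * x j - B * c j) ^+ 2 = A * (A * X - B ^+ 2).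
  transitivity (\sum_(j < N) (A ^+ 2 * x j ^+ 2 - 2 * A * B * (c j * x j)
      + B ^+ 2 * c j ^+ 2)); first by apply: eq_bigr => j _; ring.
  by rewrite big_split/= sumrB -!mulr_sumr -/A -/B -/X; ring.
move: A0; rewrite le_eqVlt => /predU1P[A0|A0]; last by rewrite pmulr_rge0// subr_ge0.
have /(psumr_eq0P (fun j _ => sqr_ge0 (c j))) c0 := esym A0.
rewrite /B big1 ?expr0n/= -?A0 ?mul0r// => j _.
by have /eqP := c0 j isT; rewrite sqrf_eq0 => /eqP ->; rewrite mul0r.
Qed.

(** Cauchy-Schwarz with the multipliers [e j] replaced by their common bound [E]. In the Gronwall
    estimate [c] is the tested vector, [e] the exponentials and [y] the data. *)
Lemma weighted_sum_bound N (c e y : 'I_N -> R) E C Y :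
  0 <= E -> 0 <= C -> 0 <= Y -> (forall j, 0 <= e j <= E) ->
  \sum_(j < N) c j ^+ 2 <= C ^+ 2 -> \sum_(j < N) y j ^+ 2 <= Y ^+ 2 ->
  `|\sum_(j < N) c j * (e j * y j)| <= C * (E * Y).
Proof.
move=> E0 C0 Y0 eE cC yY; rewrite -(@ler_pXn2r _ 2) ?nnegrE ?mulr_ge0//.
rewrite real_normK ?num_real//; apply: le_trans (sum_cauchy_schwarz _ _) _.
rewrite exprMn ler_pM// ?sumr_ge0// => [j _|j _|]; rewrite ?sqr_ge0//.
rewrite exprMn; apply: (@le_trans _ _ (E ^+ 2 * \sum_(j < N) y j ^+ 2)).
  rewrite mulr_sumr; apply: ler_sum => j _; rewrite exprMn ler_wpM2r ?sqr_ge0//.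
  by have /andP[e0 ee] := eE j; rewrite ler_pXn2r ?nnegrE.
by rewrite ler_wpM2l ?sqr_ge0.
Qed.

End real_integrals.

Section gronwall.
Set Implicit Arguments.
Unset Strict Implicit.
Context {R : realType}.
Local Notation leb := (@lebesgue_measure R).

Lemma Rintegral_exp_cst (k a b c tau : R) : 0 < k -> a <= tau ->
  let g := fun s => b * expR (k * (tau - s)) + c in
  leb.-integrable `[a, tau] (EFin \o g) /\
  \int[leb]_(s in `[a, tau]) g s = b * ((expR (k * (tau - a)) - 1) / k) + c * (tau - a).
Proof.
move=> k0 atau g.
have mI : measurable (`[a, tau]%classic : set (measurableTypeR R)).
  exact: measurable_itv.
have i1 : leb.-integrable `[a, tau] (EFin \o (fun s => expR (k * (tau - s)))).
  apply: continuous_itv_integrable; apply: continuous_subspaceT => s.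
  have := @continuous_exp_affine R (- k) tau s.
  by congr (_ _ _); apply/funext => x; rewrite mulNr -mulrN opprB.
have i2 : leb.-integrable `[a, tau] (EFin \o (fun s => b * expR (k * (tau - s)))).
  exact: (integrableZl mI b i1).
have i3 : leb.-integrable `[a, tau] (EFin \o cst c).
  by apply: continuous_itv_integrable; apply: continuous_subspaceT => s; exact: cst_continuous.
split; first exact: (integrableD mI i2 i3).
rewrite RintegralD// RintegralZl// Rintegral_exp//.
by congr (_ + _); exact: Rintegral_itv_cst.
Qed.

(** In the application [W], [D] and [G] are the first [N] coefficients of the differences of
    solutions, nonlinear terms and data, and [r] bounds the part of the difference that [W] does not
    see. In the weight, [Lam] absorbs the growth of all multipliers, while each time integration
    gains 1/k1: once for the nonlinearity, twice for the memory term. *)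
Lemma fourier_gronwall N (W D : 'I_N -> R -> R) (G lam : 'I_N -> R)
    (tau kap del r Lam k1 : R) (n := fun t => Num.sqrt (\sum_(j < N) W j t ^+ 2)) :
  0 <= tau -> 0 <= kap -> 0 <= del -> 0 <= r -> 0 <= Lam -> 1 + kap <= k1 ->
  (forall j, 0 <= lam j <= Lam) ->
  (forall j, {within `[0, tau], continuous (W j)}) ->
  (forall j t, t \in `[0, tau] -> ae_integrable leb `[t, tau]
     (fun s => expR (lam j * (s - t)) * D j s)) ->
  (forall j t, t \in `[0, tau] ->
     W j t = expR (lam j * (tau - t)) * G j
       - \int[leb]_(s in `[t, tau]) (expR (lam j * (s - t)) * D j s)
       - \int[leb]_(s in `[t, tau]) (expR (lam j * (s - t)) *
           \int[leb]_(xi in `[s, tau]) W j xi)) ->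
  \sum_(j < N) G j ^+ 2 <= del ^+ 2 ->
  (forall s, s \in `[0, tau] ->
     \sum_(j < N) D j s ^+ 2 <= (kap * (n s + r)) ^+ 2) ->
  forall t, t \in `[0, tau] ->
    n t <= expR ((Lam + k1) * (tau - t)) * (del + kap * r * tau).
Proof.
move=> tau0 kap0 del0 r0 Lam0 k1kap lamLam cW iD eqW Gdel Dn.
have k1_gt0 : 0 < k1 by lra.
have n0 s : 0 <= n s by exact: sqrtr_ge0.
have n2 s : n s ^+ 2 = \sum_(j < N) W j s ^+ 2.
  by rewrite sqr_sqrtr// sumr_ge0// => j _; exact: sqr_ge0.
have cn : {within `[0, tau], continuous n}.
  move=> s; apply: (@continuous_comp (subspace `[0, tau]) R R
    (fun s : R => \sum_(j < N) W j s ^+ 2) Num.sqrt).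
    have := @within_continuous_sum R `[0, tau] _ (index_enum 'I_N) (fun j s => W j s * W j s).
    move=> /(_ (fun j => within_continuousM (cW j) (cW j))) /(_ s).
    by congr (continuous_at _ _); apply/funext => x; apply: eq_bigr => j _; rewrite expr2.
  exact: sqrt_continuous.
pose f s := n s * expR ((Lam + k1) * (s - tau)).
have cf : {within `[0, tau], continuous f}.
  apply: within_continuousM => //; apply: continuous_subspaceT.
  exact: continuous_exp_affine.
(* Testing the equation at the maximum point [c] against [W c] closes the
   estimate in one step, since [kap / k1 + 1 / k1 ^ 2 <= 1]. *)
have [c cI fc] := EVT_max tau0 cf.
set M := f c in fc.
have M0 : 0 <= M by rewrite mulr_ge0// expR_ge0.
have nM s : s \in `[0, tau] -> n s <= M * expR ((Lam + k1) * (tau - s)).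
  move=> /fc fM; rewrite -ler_pdivrMr ?expR_gt0// -expRN.
  by rewrite -mulrN opprB.
have ncE : n c = M * expR ((Lam + k1) * (tau - c)).
  rewrite /M /f -mulrA -expRD -mulrDr.
  by rewrite addrA subrK subrr mulr0 expR0 mulr1.
clearbody M.
suff MA : M <= del + kap * r * tau.
  move=> t tI; apply: le_trans (nM t tI) _.
  by rewrite mulrC ler_wpM2l// expR_ge0.
have A0 : 0 <= del + kap * r * tau by rewrite addr_ge0// !mulr_ge0.
(* If the maximum is 0 there is nothing to show; otherwise [n c] is positive and can be divided
   out. *)
move: M0; rewrite le_eqVlt => /predU1P[<-//|M_gt0].
have /andP[c0 ctau] : 0 <= c <= tau by move: cI; rewrite in_itv.
pose x := tau - c.
have x0 : 0 <= x by rewrite subr_ge0.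
have subI s : `[c, tau]%classic s -> s \in `[0, tau].
  by rewrite /= !in_itv/= => /andP[cs ->]; rewrite (le_trans c0 cs).
have sI s : `[c, tau]%classic s -> c <= s <= tau by rewrite /= in_itv.
have eW s j : `[c, tau]%classic s -> 0 <= expR (lam j * (s - c)) <= expR (Lam * (s - c)).
  move=> /sI/andP[cs st]; rewrite expR_ge0 ler_expR ler_wpM2r ?subr_ge0//.
  by have /andP[] := lamLam j.
have cWi j : {within `[c, tau], continuous (fun s => \int[leb]_(xi in `[s, tau]) W j xi)}.
  by apply: within_subitv (tail_integral_continuous tau0 (cW j)).
pose L := expR (Lam * x).
have L0 : 0 < L by exact: expR_gt0.
(* [S1], [S2], [S3] are the contributions of the data, the nonlinearity and the memory term to
   [n c ^+ 2]. *)
pose S1 := \sum_(j < N) W j c * (expR (lam j * x) * G j).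
have S1_le : `|S1| <= n c * (L * del).
  apply: weighted_sum_bound => //; rewrite ?(ltW L0) ?n2// => j.
  by apply: (eW tau j); rewrite /= in_itv/= ctau lexx.
(* The product of e^(Lam (s - c)) and e^(Lam (tau - s)) is [L], independent of [s], so only the
   exponential in [k1] remains to be integrated. *)
pose g2 s := n c * L * kap * M * expR (k1 * (tau - s)) + n c * L * kap * r.
have [ig2 Ig2] := @Rintegral_exp_cst k1 c (n c * L * kap * M) (n c * L * kap * r) tau k1_gt0 ctau.
pose S2 := \sum_(j < N) W j c * \int[leb]_(s in `[c, tau]) (expR (lam j * (s - c)) * D j s).
have S2_le : `|S2| <= \int[leb]_(s in `[c, tau]) g2 s.
  have -> : S2 = \int[leb]_(s in `[c, tau])
      (\sum_(j < N) W j c * (expR (lam j * (s - c)) * D j s)).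
    rewrite ae_Rintegral_sum//; last by move=> j; apply: ae_integrableZl => //; exact: iD.
    by apply: eq_bigr => j _; rewrite ae_RintegralZl//; exact: iD.
  apply: le_ae_Rintegral => //.
  - by apply: ae_integrable_sum => // j; apply: ae_integrableZl => //; exact: iD.
  - exact: integrable_ae_integrable.
  move=> s sct; have /andP[cs st] := sI _ sct.
  apply: (@le_trans _ _ (n c * (expR (Lam * (s - c)) * (kap * (n s + r))))).
    apply: weighted_sum_bound; rewrite ?expR_ge0 ?mulr_ge0 ?addr_ge0 ?n2//.
      by move=> j; exact: eW.
    exact/Dn/subI.
  have -> : g2 s = n c * (kap * (L * M * expR (k1 * (tau - s)) + L * r)).
    by rewrite /g2; ring.
  rewrite ler_wpM2l// mulrCA ler_wpM2l// mulrDr lerD//.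
    apply: le_trans (ler_wpM2l (expR_ge0 _) (nM s (subI _ sct))) _.
    have -> : L * M * expR (k1 * (tau - s)) = M * (L * expR (k1 * (tau - s))) by ring.
    rewrite [leLHS]mulrCA ler_wpM2l ?(ltW M_gt0)//.
    by rewrite /L -expRD -expRD ler_expR /x le_eqVlt; apply/orP; left; apply/eqP; ring.
  by rewrite ler_wpM2r// ler_expR ler_wpM2l// lerB.
(* The inner integral over [xi] supplies the extra factor 1/k1; there e^(Lam (s - c)) e^(Lam (tau -
   xi)) <= [L] since s <= xi. *)
pose g3 s := n c * L * M / k1 * expR (k1 * (tau - s)) + 0.
have [ig3 Ig3] := @Rintegral_exp_cst k1 c (n c * L * M / k1) 0 tau k1_gt0 ctau.
pose S3 := \sum_(j < N) W j c * \int[leb]_(s in `[c, tau]) (expR (lam j * (s - c)) *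
           \int[leb]_(xi in `[s, tau]) W j xi).
have S3_le : `|S3| <= \int[leb]_(s in `[c, tau]) g3 s.
  have i3 j : ae_integrable leb `[c, tau] (fun s => expR (lam j * (s - c)) *
           \int[leb]_(xi in `[s, tau]) W j xi).
    apply/integrable_ae_integrable/continuous_itv_integrable.
    apply: within_continuousM => //; apply: continuous_subspaceT.
    exact: continuous_exp_affine.
  have -> : S3 = \int[leb]_(s in `[c, tau])
      (\sum_(j < N) W j c * (expR (lam j * (s - c)) * \int[leb]_(xi in `[s, tau]) W j xi)).
    rewrite ae_Rintegral_sum//; last by move=> j; apply: ae_integrableZl.
    by apply: eq_bigr => j _; rewrite ae_RintegralZl.
  apply: le_ae_Rintegral => //.
  - by apply: ae_integrable_sum => // j; apply: ae_integrableZl.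
  - exact: integrable_ae_integrable.
  move=> s sct; have /andP[cs st] := sI _ sct.
  have s0 : 0 <= s by exact: le_trans cs.
  have iW j : ae_integrable leb `[s, tau] (W j).
    by apply/integrable_ae_integrable/continuous_itv_integrable/(within_subitv _ _ (cW j)).
  have iW' j : ae_integrable leb `[s, tau] (fun xi => W j c * (expR (lam j * (s - c)) * W j xi)).
    by do 2 apply: ae_integrableZl => //.
  have -> : \sum_(j < N) W j c * (expR (lam j * (s - c)) * \int[leb]_(xi in `[s, tau]) W j xi) =
      \int[leb]_(xi in `[s, tau]) (\sum_(j < N) W j c * (expR (lam j * (s - c)) * W j xi)).
    rewrite ae_Rintegral_sum//; apply: eq_bigr => j _.
    by rewrite !ae_RintegralZl//; exact: ae_integrableZl.
  have [ig Ig] := @Rintegral_exp_cst k1 s (n c * L * M) 0 tau k1_gt0 st.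
  apply: (@le_trans _ _ (\int[leb]_(xi in `[s, tau]) (n c * L * M * expR (k1 * (tau - xi)) + 0))).
    apply: le_ae_Rintegral => //.
    - exact: ae_integrable_sum.
    - exact: integrable_ae_integrable.
    move=> xi /=; rewrite in_itv/= => /andP[sxi xit].
    apply: (@le_trans _ _ (n c * (expR (Lam * (s - c)) * n xi))).
      apply: weighted_sum_bound; rewrite ?expR_ge0 ?n2// => j; exact: eW.
    rewrite addr0 -!mulrA ler_wpM2l//.
    have xiI : xi \in `[0, tau] by rewrite in_itv/= xit (le_trans s0 sxi).
    apply: le_trans (ler_wpM2l (expR_ge0 _) (nM xi xiI)) _.
    rewrite mulrCA [leRHS]mulrCA ler_wpM2l ?(ltW M_gt0)// /L -!expRD ler_expR.
    have : Lam * s <= Lam * xi by rewrite ler_wpM2l.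
    by rewrite /x; nra.
  rewrite Ig /g3 mul0r !addr0 -!mulrA !ler_wpM2l ?(ltW L0) ?(ltW M_gt0)//.
  by rewrite [leRHS]mulrC ler_wpM2r ?invr_ge0 ?(ltW k1_gt0)// gerDl oppr_le0.
have nc2 : n c ^+ 2 = S1 - S2 - S3.
  rewrite n2 /S1 /S2 /S3 -!sumrB; apply: eq_bigr => j _.
  by rewrite -!mulrBr expr2; congr (_ * _); exact: eqW.
have le1 : n c ^+ 2 <= n c * L * (del + kap * r * x +
    M * (expR (k1 * x) - 1) * (kap / k1 + k1^-1 / k1)).
  rewrite nc2.
  have := ler_norm S1; have := ler_norm (- S2); have := ler_norm (- S3).
  rewrite !normrN.
  move: S1_le S2_le S3_le; rewrite Ig2 Ig3 -/x.
  set Q := expR (k1 * x) - 1.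
  have -> : n c * L * (del + kap * r * x + M * Q * (kap / k1 + k1^-1 / k1)) =
    n c * (L * del) + (n c * L * kap * M * (Q / k1) + n c * L * kap * r * x) +
    (n c * L * M / k1 * (Q / k1) + 0 * x) by ring.
  by lra.
have nc_gt0 : 0 < n c by rewrite ncE mulr_gt0 ?expR_gt0.
move: le1; rewrite expr2 -mulrA ler_pM2l// ncE mulrDl expRD -/x -/L.
rewrite mulrCA ler_pM2l//.
set Q := expR (k1 * x).
have Q1 : 1 <= Q by rewrite -expR0 ler_expR mulr_ge0 ?(ltW k1_gt0).
have fact : kap / k1 + k1^-1 / k1 <= 1.
  rewrite -mulrDl ler_pdivrMr// mul1r.
  have : k1^-1 <= 1 by rewrite invf_le1//; lra.
  lra.
(* The left side of the goal is [M * Q]. The [- 1] produced by the upper end of the exponential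
   integrals is decisive: with the factor bounded by 1, [M * Q] cancels and [M] itself is
   bounded. *)
have h1 : M * (Q - 1) * (kap / k1 + k1^-1 / k1) <= M * (Q - 1).
  by rewrite ler_piMr// mulr_ge0 ?subr_ge0 ?(ltW M_gt0).
have h2 : kap * r * x <= kap * r * tau.
  by rewrite ler_wpM2l ?mulr_ge0// /x; lra.
by lra.
Qed.

End gronwall.

(** * The regularized problem *)

Section fourier.
Set Implicit Arguments.
Unset Strict Implicit.
Context {R : realType} {d : nat} {Omega : smooth_domain R d}.
Variables (lam : nat -> R) (phi : nat -> L2 Omega).
Hypothesis lam_phi : dirichlet_eigenbasis lam phi.
Implicit Types (f g h : L2 Omega) (N M : nat).
Local Notation leb := (@lebesgue_measure R).
Local Notation mset := (fun D : set R => measurable (D : set (measurableTypeR R))).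

Definition fproj N f : L2 Omega := \sum_(j < N) inner f (phi j) *: phi j.

Lemma inner_phi i j : inner (phi i) (phi j) = (i == j)%:R.
Proof. by have [_ _ H _] := lam_phi. Qed.

Lemma eigenvalue_gt0 j : 0 < lam j.
Proof. by have [[]] := lam_phi. Qed.

Lemma eigenvalue_le : {homo lam : i j / (i <= j)%N >-> i <= j}.
Proof. by have [[]] := lam_phi. Qed.

Lemma inner_lincomb N (c : nat -> R) k :
  inner (\sum_(j < N) c j *: phi j) (phi k) = if (k < N)%N then c k else 0.
Proof.
rewrite inner_suml; under eq_bigr do rewrite innerZl inner_phi.
case: ifPn => [kN|]; last first.
  rewrite -leqNgt => Nk; rewrite big1// => j _.
  by rewrite ltn_eqF ?mulr0// (leq_trans (ltn_ord j)).
rewrite (bigD1 (Ordinal kN))//= eqxx mulr1 big1 ?addr0// => j jk.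
by rewrite (negbTE (jk : nat_of_ord j != k)) mulr0.
Qed.

Lemma norm2_lincomb N (c : nat -> R) :
  norm2 (\sum_(j < N) c j *: phi j) ^+ 2 = \sum_(j < N) c j ^+ 2.
Proof.
rewrite norm2_sqr inner_sumr; apply: eq_bigr => j _.
by rewrite innerZr inner_lincomb ltn_ord expr2.
Qed.

Lemma norm2_fproj N f : norm2 (fproj N f) ^+ 2 = \sum_(j < N) inner f (phi j) ^+ 2.
Proof. exact: (norm2_lincomb N (fun j => inner f (phi j))). Qed.

Lemma bessel N f : \sum_(j < N) inner f (phi j) ^+ 2 <= norm2 f ^+ 2.
Proof.
have f0 := sqr_ge0 (norm2 (f - fproj N f)).
rewrite -subr_ge0; suff <- : norm2 (f - fproj N f) ^+ 2 =
  norm2 f ^+ 2 - \sum_(j < N) inner f (phi j) ^+ 2 by [].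
rewrite norm2_sqr innerBl !innerBr -!norm2_sqr norm2_fproj.
suff e : inner f (fproj N f) = \sum_(j < N) inner f (phi j) ^+ 2.
  by rewrite (innerC _ f) e; ring.
by rewrite inner_sumr; apply: eq_bigr => j _; rewrite innerZr expr2.
Qed.

Lemma fproj_cvg f : norm2 (f - fproj n f) @[n --> \oo] --> 0.
Proof. by have [_ _ _ H] := lam_phi; exact: H. Qed.

(** The tail is the limit of the finite blocks from [N] to [N + M], so bounds on blocks suffice and
    no infinite Parseval identity enters. *)
Lemma norm2_tail N f r : 0 <= r ->
  (forall M, \sum_(N <= j < N + M) inner f (phi j) ^+ 2 <= r ^+ 2) ->
  norm2 (f - fproj N f) <= r.
Proof.
move=> r0 fr; apply/ler_addgt0Pl => e e0.
have /cvgrPdist_le /(_ e e0) [M _ /(_ (N + M)%N (leq_addl _ _))] := fproj_cvg f.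
rewrite /= sub0r normrN ger0_norm ?norm2_ge0// => fM.
apply: le_trans (norm2_triangle (fproj (N + M) f) _ _) _; apply: lerD => //.
rewrite -(@ler_pXn2r _ 2) ?nnegrE ?norm2_ge0//; apply: le_trans (fr M).
(* Masking the first [N] coefficients turns the block into a single linear combination, to which
   [norm2_lincomb] applies. *)
pose c j := if (N <= j)%N then inner f (phi j) else 0.
have -> : fproj (N + M) f - fproj N f = \sum_(j < N + M) c j *: phi j.
  rewrite /fproj -!(big_mkord xpredT (fun j => inner f (phi j) *: phi j)).
  rewrite -(big_mkord xpredT (fun j => c j *: phi j)).
  rewrite (@big_cat_nat _ _ _ N 0 (N + M))//= ?leq_addr//.
  rewrite [in RHS](@big_cat_nat _ _ _ N 0 (N + M))//= ?leq_addr//.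
  rewrite addrAC subrr add0r [X in _ = X + _]big_nat_cond [X in _ = X + _]big1 ?add0r.
    by apply: eq_big_nat => j /andP[Nj _]; rewrite /c Nj.
  by move=> j /andP[/andP[_ jN] _]; rewrite /c leqNgt jN scale0r.
rewrite norm2_lincomb -(big_mkord xpredT (fun j => c j ^+ 2)).
rewrite (@big_cat_nat _ _ _ N 0 (N + M))//= ?leq_addr//.
rewrite big_nat_cond big1 ?add0r.
  by rewrite le_eqVlt; apply/orP; left; apply/eqP; apply: eq_big_nat => j /andP[Nj _]; rewrite /c Nj.
by move=> j /andP[/andP[_ jN] _]; rewrite /c leqNgt jN expr0n.
Qed.

Lemma fproj_id N f : (forall k, (N <= k)%N -> inner f (phi k) = 0) ->
  norm2 (f - fproj N f) = 0.
Proof.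
move=> fN; apply/eqP; rewrite eq_le norm2_ge0 andbT; apply: norm2_tail => // M.
rewrite big_nat_cond big1 ?expr0n// => j /andP[/andP[Nj _] _].
by rewrite fN// expr0n.
Qed.

Lemma inner_continuous tau (v : R -> L2 Omega) h : continuous_L2 tau v ->
  {within `[0, tau], continuous (fun t => inner (v t) h)}.
Proof.
move=> cv; apply/subspace_continuousP => t tI; apply: inner_cvg.
by under eq_fun do rewrite norm2C; exact: cv.
Qed.

Lemma bochner_integralP (D : set R) (v : R -> L2 Omega) : bochner_integrable D v ->
  is_bochner_integral D v (bochner_integral D v).
Proof. exact: xgetPex. Qed.

(** If no integral exists, [bochner_integral] is the default 0, which is orthogonal to [h] too. The
    lemma can therefore be used before the memory term is known to be integrable. *)
Lemma bochner_integral_inner0 (D : set R) (v : R -> L2 Omega) h : mset D ->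
  (forall s, D s -> inner (v s) h = 0) -> inner (bochner_integral D v) h = 0.
Proof.
move=> mD v0; rewrite /bochner_integral; case: xgetP => [I _ DI|_]; last first.
  exact: inner0l.
have [_ ->] := bochner_inner h mD DI.
under eq_Rintegral => s /set_mem /v0 -> do over.
by rewrite /Rintegral integral0.
Qed.

Lemma innerBBl f g h k a b c : inner f k = a -> inner g k = b -> inner h k = c ->
  inner (f - g - h) k = a - b - c.
Proof. by rewrite !innerBl => -> -> ->. Qed.

Lemma inner_S_trunc N t f k :
  inner (S_trunc lam phi N t f) (phi k) =
    if (k < N)%N then expR (lam k * t) * inner f (phi k) else 0.
Proof. exact: (inner_lincomb N (fun j => expR (lam j * t) * inner f (phi j))). Qed.

Section regularized.
Variables (tau : R) (F : R -> L2 Omega -> L2 Omega) (N : nat) (g : L2 Omega).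
Variable v : R -> L2 Omega.
Hypotheses (tau_gt0 : 0 < tau) (cv : continuous_L2 tau v).
Hypothesis vsol : regularized_solution tau lam phi F N g v.

(** The three terms of the equation take values in, or integrate values in, the range of [S_trunc],
    to which [phi k] is orthogonal. *)
Lemma regularized_span t k : t \in `[0, tau] -> (N <= k)%N -> inner (v t) (phi k) = 0.
Proof.
move=> tI Nk; have [_ vE] := vsol tI; rewrite (inner_cong (phi k) vE).
have mI : mset `[t, tau]%classic by exact: measurable_itv.
have z (w : R -> L2 Omega) : inner (bochner_integral `[t, tau] (fun s => S_trunc lam phi N (s - t) (w s)))
    (phi k) = 0.
  apply: bochner_integral_inner0 => // s _.
  by rewrite inner_S_trunc ltnNge Nk.
have z0 : 0 = 0 - 0 - 0 :> R by rewrite !subr0.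
rewrite [RHS]z0; apply: innerBBl; [by rewrite inner_S_trunc ltnNge Nk|exact: z|exact: z].
Qed.

(** By [regularized_span], [v] is a combination of [N] fixed vectors with continuous
    coefficients. *)
Lemma regularized_bochner s : s \in `[0, tau] ->
  is_bochner_integral `[s, tau] v (bochner_integral `[s, tau] v).
Proof.
rewrite in_itv/= => /andP[s0 st]; apply: bochner_integralP.
eexists; apply: (@bochner_finite _ _ _ N (fun j x => inner (v x) (phi j)) (fun j => phi j)).
- exact: measurable_itv.
- exact: lebesgue_itv_lty.
- by move=> j; apply/continuous_itv_integrable/(within_subitv s0 (lexx _))/inner_continuous.
- move=> x; rewrite /= in_itv/= => /andP[sx xt].
  apply: fproj_id => k; apply: regularized_span.
  by rewrite in_itv/= xt (le_trans s0 sx).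
Qed.

Lemma regularized_coefficient j t : (j < N)%N -> t \in `[0, tau] ->
  ae_integrable leb `[t, tau] (fun s => expR (lam j * (s - t)) * inner (F s (v s)) (phi j)) /\
  inner (v t) (phi j) =
    expR (lam j * (tau - t)) * inner g (phi j)
    - \int[leb]_(s in `[t, tau]) (expR (lam j * (s - t)) * inner (F s (v s)) (phi j))
    - \int[leb]_(s in `[t, tau]) (expR (lam j * (s - t)) *
         \int[leb]_(xi in `[s, tau]) inner (v xi) (phi j)).
Proof.
move=> jN tI; have /andP[t0 tt] : 0 <= t <= tau by move: tI; rewrite in_itv.
have [Fi vE] := vsol tI.
have mI : mset `[t, tau]%classic by exact: measurable_itv.
have [iF IF] := bochner_inner (phi j) mI (bochner_integralP Fi).
have eF : (fun s => inner (S_trunc lam phi N (s - t) (F s (v s))) (phi j)) =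
    (fun s => expR (lam j * (s - t)) * inner (F s (v s)) (phi j)).
  by apply/funext => s; rewrite inner_S_trunc jN.
rewrite eF in iF IF; split => //.
rewrite (inner_cong (phi j) vE).
apply: innerBBl; [by rewrite inner_S_trunc jN|exact: IF|].
have inB s k : s \in `[0, tau] ->
    inner (bochner_integral `[s, tau] v) (phi k) = \int[leb]_(xi in `[s, tau]) inner (v xi) (phi k).
  move=> sI; have mIs : mset `[s, tau]%classic by exact: measurable_itv.
  by have [] := bochner_inner (phi k) mIs (regularized_bochner sI).
have tsI s : `[t, tau]%classic s -> s \in `[0, tau].
  by rewrite /= !in_itv/= => /andP[ts ->]; rewrite (le_trans t0 ts).
(* Without integrability the outer integral would be the default 0 and carry no information. Its
   integrand is again a finite combination with continuous coefficients. *)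
have Bi : bochner_integrable `[t, tau]
    (fun s => S_trunc lam phi N (s - t) (bochner_integral `[s, tau] v)).
  eexists; apply: (@bochner_finite _ _ _ N (fun j s => expR (lam j * (s - t)) *
         \int[leb]_(xi in `[s, tau]) inner (v xi) (phi j)) (fun j => phi j)) => //.
  - exact: lebesgue_itv_lty.
  - move=> k; apply: continuous_itv_integrable; apply: within_continuousM.
      by apply: continuous_subspaceT; exact: continuous_exp_affine.
    apply: (within_subitv t0 (lexx tau)); apply: tail_integral_continuous (ltW tau_gt0) _.
    exact: inner_continuous.
  - move=> s /tsI sI; rewrite (_ : S_trunc _ _ _ _ _ = \sum_(k < N)
        (expR (lam k * (s - t)) * \int[leb]_(xi in `[s, tau]) inner (v xi) (phi k)) *: phi k).
      by rewrite subrr norm2_0.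
    by apply: eq_bigr => k _; rewrite inB.
have [_ IB] := bochner_inner (phi j) mI (bochner_integralP Bi).
apply: etrans IB _; apply: eq_Rintegral => s /set_mem/tsI sI.
by rewrite inner_S_trunc jN inB.
Qed.

End regularized.
End fourier.

(** * The error at a fixed truncation level *)

Section error_estimate.
Set Implicit Arguments.
Unset Strict Implicit.
Context {R : realType} {d : nat} {Omega : smooth_domain R d}.
Variables (lam : nat -> R) (phi : nat -> L2 Omega).
Hypothesis lam_phi : dirichlet_eigenbasis lam phi.
Variable tau : R.
Hypothesis tau_gt0 : 0 < tau.
Local Notation leb := (@lebesgue_measure R).

Let weight (a b : R) j := lam j `^ (2 * a) * expR (2 * b * lam j).

Lemma gevrey_norm_partial a b (f : L2 Omega) rho M :
  (gevrey_norm lam phi a b f <= rho%:E)%E ->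
  \sum_(j < M) weight a b j * inner f (phi j) ^+ 2 <= rho ^+ 2.
Proof.
rewrite /gevrey_norm; set S := (X in (X `^ _)%E) => Srho.
have t0 j : 0 <= lam j `^ (2 * a) * expR (2 * b * lam j) * `|inner f (phi j)| ^+ 2.
  by rewrite !mulr_ge0 ?powR_ge0 ?expR_ge0 ?sqr_ge0.
have S0 : (0 <= S)%E by apply: nneseries_ge0 => j _ _; rewrite lee_fin.
have rho0 : 0 <= rho by rewrite -lee_fin (le_trans _ Srho)// poweR_ge0.
have : (S <= (rho ^+ 2)%:E)%E.
  have -> : S = ((S `^ 2^-1) `^ 2)%E by rewrite -poweRrM mulVf// poweRe1.
  rewrite -powR_mulrn// -poweR_EFin; apply: gt0_ler_poweR => //.
    by rewrite in_itv/= poweR_ge0 leey.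
  by rewrite in_itv/= lee_fin rho0 leey.
apply: contraTT; rewrite -!ltNge -lte_fin => H; apply: lt_le_trans H _.
apply: le_trans (nneseries_lim_ge M _); last by move=> j _ _; rewrite lee_fin.
rewrite big_mkord sumEFin lee_fin le_eqVlt; apply/orP; left; apply/eqP.
by apply: eq_bigr => j _; rewrite real_normK ?num_real.
Qed.

(** A value above [c] would persist on an open interval inside []0, tau[], which has positive
    measure. *)
Lemma ae_le_continuous (f : R -> R) c : {within `[0, tau], continuous f} ->
  {ae mrestr leb (measurable_itv `]0, tau[), forall t, f t <= c} ->
  forall t : R, t \in `[0, tau] -> f t <= c.
Proof.
move=> /subspace_continuousP cf [N [mN N0 fN]] t tI.
rewrite leNgt; apply/negP => cft.
have /cvgrPdist_lt := cf t tI.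
move=> /(_ (f t - c)); rewrite subr_gt0 => /(_ cft) /nbhs_ballP[e /= e0 eP].
have /andP[t0 tt] : 0 <= t <= tau by move: tI; rewrite in_itv.
(* Clipping the neighbourhood of [t] to []0, tau[] leaves a nonempty interval even when [t] is an
   endpoint. *)
pose l : R := Num.max 0 (t - e); pose r : R := Num.min tau (t + e).
have lr : l < r.
  rewrite lt_min !gt_max tau_gt0 (ltr_wpDl t0 e0) ltrD2l (lt_trans _ e0) ?oppr_lt0//.
  by rewrite ltrBlDr (le_lt_trans tt) ?ltrDl.
have sub : `]l, r[ `<=` N `&` `]0, tau[.
  move=> s /=; rewrite !in_itv/= /l /r gt_max lt_min => /andP[/andP[s0 ls] /andP[st sr]].
  split; last by rewrite s0.
  apply: fN => /= fs.
  have := eP s; rewrite /ball/= => /(_ _ _); rewrite ltr_norml.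
  have -> : (- e < t - s) && (t - s < e).
    by rewrite ltrNl opprB ltrBlDl sr ltrBlDl -ltrBlDr ls.
  move=> /(_ isT); rewrite in_itv/= !ltW// => /(_ isT).
  by have := ler_norm (f t - f s); lra.
have : (leb `]l, r[ <= leb (N `&` `]0%R, tau[))%E.
  by apply: le_measure => //; apply: mem_set => //; exact: measurableI.
by move: N0; rewrite /mrestr => ->; rewrite leNgt lebesgue_measure_itv/= lte_fin lr
  -EFinB lte_fin subr_gt0 lr.
Qed.

Lemma Linfty_gevrey_partial a b (v : R -> L2 Omega) rho M :
  continuous_L2 tau v -> (Linfty_gevrey_norm tau lam phi a b v <= rho%:E)%E ->
  forall t, t \in `[0, tau] ->
  \sum_(j < M) weight a b j * inner (v t) (phi j) ^+ 2 <= rho ^+ 2.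
Proof.
move=> cv /ess_supP vrho; apply: ae_le_continuous.
  apply: within_continuous_sum => j; apply: within_continuousM.
    by apply: continuous_subspaceT => x; exact: cst_continuous.
  have ci := inner_continuous (h := phi j) cv.
  exact: (within_continuousM ci ci).
by apply: filterS vrho => t; exact: gevrey_norm_partial.
Qed.

(** The weights are nondecreasing in [j], so the squared tail is at most [rho ^+ 2] over the first
    weight cut off. With indices from 0, [lam N] is lambda_(N+1). *)
Lemma Linfty_gevrey_tail a b (v : R -> L2 Omega) rho N :
  0 <= a -> 0 <= b -> 0 <= rho ->
  continuous_L2 tau v -> (Linfty_gevrey_norm tau lam phi a b v <= rho%:E)%E ->
  forall t, t \in `[0, tau] ->
  norm2 (v t - fproj phi N (v t)) <= rho * (lam N `^ (- a) * expR (- (b * lam N))).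
Proof.
move=> a0 b0 rho0 cv vrho t tI.
have l0 j := eigenvalue_gt0 lam_phi j.
apply: (norm2_tail lam_phi) => [|M].
  by rewrite !mulr_ge0 ?powR_ge0 ?expR_ge0.
have w0 j : 0 < weight a b j by rewrite mulr_gt0 ?powR_gt0 ?expR_gt0.
have wle j : (N <= j)%N -> weight a b N <= weight a b j.
  move=> Nj; have lNj := eigenvalue_le lam_phi Nj.
  rewrite /weight ler_pM ?powR_ge0 ?expR_ge0//.
    by apply: ge0_ler_powR; rewrite ?nnegrE ?mulr_ge0// ltW.
  by rewrite ler_expR ler_wpM2l// mulr_ge0.
have -> : (rho * (lam N `^ (- a) * expR (- (b * lam N)))) ^+ 2 = rho ^+ 2 / weight a b N.
  rewrite !exprMn; congr (_ * _); rewrite /weight invfM.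
  rewrite -powR_mulrn ?powR_ge0// -powRrM -powRN -expRN -expRM_natl.
  by congr (_ `^ _ * expR _); ring.
rewrite ler_pdivlMr// mulr_suml.
apply: le_trans (Linfty_gevrey_partial (N + M) cv vrho tI).
rewrite -(big_mkord xpredT (fun j => weight a b j * inner (v t) (phi j) ^+ 2)).
rewrite [leRHS](@big_cat_nat _ _ _ N 0 (N + M))//= ?leq_addr//.
rewrite ler_wpDl ?sumr_ge0// => [j _|]; first by rewrite mulr_ge0 ?sqr_ge0 ?ltW.
rewrite big_nat_cond [leRHS]big_nat_cond; apply: ler_sum => j /andP[/andP[Nj _] _].
by rewrite mulrC ler_wpM2r ?sqr_ge0// wle.
Qed.

Section error.
Variables (F : R -> L2 Omega -> L2 Omega) (kappa : R).
Hypothesis kappa_ge0 : 0 <= kappa.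
Hypothesis F_lip : forall s, s \in `[0, tau] -> forall f h : L2 Omega,
  norm2 (F s f - F s h) <= kappa * norm2 (f - h).
Variables (g gd : L2 Omega) (u v : R -> L2 Omega) (N : nat) (del r : R).
Hypotheses (N_gt0 : (0 < N)%N) (del_ge0 : 0 <= del) (r_ge0 : 0 <= r).
Hypotheses (cu : continuous_L2 tau u) (cv : continuous_L2 tau v).
Hypothesis uF : bochner_integrable `[0, tau] (fun s => F s (u s)).
Hypothesis u_coef : coefficient_formula tau lam phi F g u.
Hypothesis v_sol : regularized_solution tau lam phi F N gd v.
Hypothesis gdg : norm2 (gd - g) <= del.
Hypothesis u_tail : forall s, s \in `[0, tau] -> norm2 (u s - fproj phi N (u s)) <= r.

Lemma regularized_error t k1 : 1 + kappa <= k1 -> t \in `[0, tau] ->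
  norm2 (u t - v t) <=
    expR ((lam N.-1 + k1) * (tau - t)) * (del + kappa * r * tau) + r.
Proof.
move=> k1kap tI.
pose W (j : 'I_N) s := inner (v s - u s) (phi j).
pose D (j : 'I_N) s := inner (F s (v s) - F s (u s)) (phi j).
pose n s := Num.sqrt (\sum_(j < N) W j s ^+ 2).
have nE s : n s = norm2 (fproj phi N (v s - u s)).
  by rewrite /n -(norm2_fproj lam_phi) sqrtr_sqr ger0_norm ?norm2_ge0.
(* As [v s] has no component beyond [N], the difference [v s - u s] consists of its projection and
   the tail of [u s]. *)
have dn s : s \in `[0, tau] -> norm2 (v s - u s) <= n s + r.
  move=> sI; apply: le_trans (norm2_triangle (fproj phi N (v s)) _ _) _.
  rewrite (fproj_id lam_phi) ?add0r; last first.
    by move=> k; exact: (regularized_span lam_phi v_sol sI).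
  apply: le_trans (norm2_triangle (fproj phi N (u s)) _ _) _.
  rewrite nE lerD//; last by rewrite norm2C u_tail.
  rewrite /fproj -sumrB le_eqVlt; apply/orP; left; apply/eqP; congr norm2.
  by apply: eq_bigr => j _; rewrite [in RHS]innerBl scalerBl.
rewrite norm2C; apply: le_trans (dn t tI) _; rewrite lerD2r.
(* The coefficients of [F x (u x)] are integrable off a null set by pairing with [phi j]; the
   exponential is bounded on the compact interval. *)
have iFu j s : s \in `[0, tau] -> ae_integrable leb `[s, tau]
    (fun x => expR (lam j * (x - s)) * inner (F x (u x)) (phi j)).
  rewrite in_itv/= => /andP[s0 st].
  have mI : measurable (`[0, tau]%classic : set (measurableTypeR R)) by exact: measurable_itv.
  have mIs : measurable (`[s, tau]%classic : set (measurableTypeR R)) by exact: measurable_itv.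
  have [iF _] := bochner_inner (phi j) mI (bochner_integralP uF).
  have cE : continuous (fun x => expR (lam j * (x - s))) by exact: continuous_exp_affine.
  apply: ae_integrableM => //.
  - by apply: (@measurable_funS _ _ _ _ setT) => //; exact: continuous_measurable_fun.
  - have := @continuous_compact R R (fun x => expR (lam j * (x - s))) `[s, tau].
    move=> /(_ (continuous_subspaceT cE) (@segment_compact _ _ _)) /compact_bounded.
    by case=> B [rB bB]; exists B; split => // y /bB H x xI; apply: H; exists x.
  - apply: ae_integrableS iF => //; apply: subset_itvr; by rewrite bnd_simp.
have iFv (j : 'I_N) s (sI : s \in `[0, tau]) :=
  (regularized_coefficient lam_phi tau_gt0 cv v_sol (ltn_ord j) sI).1.
have mul j s x : expR (lam j * (x - s)) * inner (F x (v x)) (phi j) -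
    expR (lam j * (x - s)) * inner (F x (u x)) (phi j) =
    expR (lam j * (x - s)) * inner (F x (v x) - F x (u x)) (phi j).
  by rewrite -mulrBr innerBl.
apply: (@fourier_gronwall R N W D (fun j => inner (gd - g) (phi j))
   (fun j => lam j) tau kappa del r (lam N.-1) k1) => //.
- exact: ltW.
- exact/ltW/(eigenvalue_gt0 lam_phi).
- move=> j; rewrite (ltW (eigenvalue_gt0 lam_phi _))/=.
  by apply: (eigenvalue_le lam_phi); rewrite -ltnS prednK.
- move=> j.
  have -> : W j = fun s => inner (v s) (phi j) - inner (u s) (phi j).
    by apply/funext => s; exact: innerBl.
  have /subspace_continuousP c1 := inner_continuous (h := phi j) cv.
  have /subspace_continuousP c2 := inner_continuous (h := phi j) cu.
  by apply/subspace_continuousP => s sI; apply: cvgB; [exact: c1|exact: c2].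
- move=> j s sI; have mIs : measurable (`[s, tau]%classic : set (measurableTypeR R)) by exact: measurable_itv.
  have := ae_integrableB mIs (iFv j s sI) (iFu j s sI).
  by congr ae_integrable; apply/funext => x; exact: mul.
- move=> j s sI; have /andP[s0 st] : 0 <= s <= tau by move: sI; rewrite in_itv.
  have mIs x : measurable (`[x, tau]%classic : set (measurableTypeR R)) by exact: measurable_itv.
  have iW w : continuous_L2 tau w -> ae_integrable leb `[s, tau] (fun x =>
      expR (lam j * (x - s)) * \int[leb]_(xi in `[x, tau]) inner (w xi) (phi j)).
    move=> cw; apply/integrable_ae_integrable/continuous_itv_integrable.
    apply: within_continuousM.
      by apply: continuous_subspaceT; exact: continuous_exp_affine.
    apply: (within_subitv s0 (lexx tau)); apply: tail_integral_continuous (ltW tau_gt0) _.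
    exact: inner_continuous.
  have [_ Ev] := regularized_coefficient lam_phi tau_gt0 cv v_sol (ltn_ord j) sI.
  have Eu := u_coef j sI.
  rewrite /W innerBl Ev Eu {Ev Eu}; cbv beta; rewrite (innerBl gd) [expR _ * (_ - _)]mulrBr.
  have -> : \int[leb]_(x in `[s, tau]) (expR (lam j * (x - s)) * D j x) =
     \int[leb]_(x in `[s, tau]) (expR (lam j * (x - s)) * inner (F x (v x)) (phi j)) -
     \int[leb]_(x in `[s, tau]) (expR (lam j * (x - s)) * inner (F x (u x)) (phi j)).
    rewrite -ae_RintegralB//; [|exact: iFv|exact: iFu].
    by apply: eq_Rintegral => x _; exact/esym/mul.
  have -> : \int[leb]_(x in `[s, tau]) (expR (lam j * (x - s)) *
        \int[leb]_(xi in `[x, tau]) inner (v xi - u xi) (phi j)) =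
     \int[leb]_(x in `[s, tau]) (expR (lam j * (x - s)) *
        \int[leb]_(xi in `[x, tau]) inner (v xi) (phi j)) -
     \int[leb]_(x in `[s, tau]) (expR (lam j * (x - s)) *
        \int[leb]_(xi in `[x, tau]) inner (u xi) (phi j)).
    rewrite -ae_RintegralB//; [|exact: iW|exact: iW].
    apply: eq_Rintegral => x /set_mem/=; rewrite in_itv/= => /andP[sx xt].
    have iI w : continuous_L2 tau w ->
        leb.-integrable `[x, tau] (EFin \o (fun xi => inner (w xi) (phi j))).
      move=> cw; apply: continuous_itv_integrable.
      by apply: (within_subitv (le_trans s0 sx) (lexx tau)); exact: inner_continuous.
    rewrite -mulrBr -RintegralB//; [|exact: iI|exact: iI].
    by congr (_ * _); apply: eq_Rintegral => xi _; rewrite innerBl.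
  have sub3 (a b c a' b' c' : R) :
    a - b - c - (a' - b' - c') = a - a' - (b - b') - (c - c') by ring.
  exact: sub3.
- apply: le_trans (bessel lam_phi N _) _.
  by rewrite ler_pXn2r ?nnegrE ?norm2_ge0.
(* The Lipschitz bound sees the full difference, whence the tail bound [r] next to [n s]. *)
- move=> s sI; apply: le_trans (bessel lam_phi N _) _.
  rewrite ler_pXn2r ?nnegrE ?norm2_ge0//; last first.
    by rewrite mulr_ge0// addr_ge0// sqrtr_ge0.
  apply: le_trans (F_lip sI _ _) _; rewrite ler_wpM2l//; exact: dn.
Qed.

End error.
End error_estimate.

(** * Choice of the truncation level *)

Section truncation_level.
Set Implicit Arguments.
Unset Strict Implicit.
Context {R : realType}.

(** With s the square root of y, c ln y = 2 c ln s <= 2 c s <= s^2 / 2, because 4 c <= s. The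
    summand 2 in the threshold later gives X >= y / 2 >= 1. *)
Lemma ln_le_half (c y : R) : 0 < c -> 2 + (4 * c) ^+ 2 <= y -> c * ln y <= y / 2.
Proof.
move=> c0 cy; have y0 : 0 < y by nra.
have sy : 4 * c <= Num.sqrt y.
  rewrite -(@ler_pXn2r _ 2) ?nnegrE ?sqrtr_ge0 ?mulr_ge0 ?ltW//.
  by rewrite sqr_sqrtr ?ltW//; lra.
have s0 : 0 < Num.sqrt y by rewrite sqrtr_gt0.
have yE : y = Num.sqrt y ^+ 2 by rewrite sqr_sqrtr// ltW.
have ls : ln (Num.sqrt y) <= Num.sqrt y - 1.
  have -> : Num.sqrt y = 1 + (Num.sqrt y - 1) by ring.
  rewrite addrAC subrr add0r; apply: le_ln1Dx; lra.
rewrite {1}yE lnXn// -mulr_natr {2}yE.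
nra.
Qed.

Lemma ln_ratio_ge (rho del K : R) : 0 < rho -> 0 < del ->
  del <= rho * expR (- K) -> K <= ln (rho / del).
Proof.
move=> rho0 del0 dK; rewrite -[leLHS]expRK ler_ln ?posrE ?expR_gt0 ?divr_gt0//.
by rewrite ler_pdivlMr// mulrC -ler_pdivlMr ?expR_gt0// -expRN.
Qed.

Lemma powR_expR (a x : R) : 0 < a -> a `^ x = expR (x * ln a).
Proof. by move=> a0; rewrite /powR gt_eqF. Qed.

(** The powers d/2 and 2/d are inverse, so N <= X^(d/2) < N + 1 reads N^(2/d) <= X < (N + 1)^(2/d).
    Here [lam N.-1] and [lam N] are lambda_N and lambda_(N+1), and X >= 1 ensures that [N] is
    positive. *)
Lemma truncn_level (d : nat) (lam : nat -> R) (e1 e2 X : R) (N := Num.truncn (X `^ (d%:R / 2))) :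
  (0 < d)%N -> 0 < e1 -> 0 < e2 -> 1 <= X ->
  (forall j : nat,
     e1 * j.+1%:R `^ (2 / d%:R) <= lam j <= e2 * j.+1%:R `^ (2 / d%:R)) ->
  [/\ (0 < N)%N, e1 * X <= lam N & lam N.-1 <= e2 * X].
Proof.
move=> d0 e10 e20 X1 lamb; pose Y := X `^ (d%:R / 2).
have dR : (d%:R : R) != 0 by rewrite pnatr_eq0 -lt0n.
have Y1 : 1 <= Y.
  have <- : (1 : R) `^ (d%:R / 2) = 1 by rewrite powR1.
  by apply: ge0_ler_powR; rewrite ?nnegrE ?divr_ge0//; lra.
have YX : Y `^ (2 / d%:R) = X.
  rewrite -powRrM (_ : _ / _ * _ = 1) ?powRr1//; last by field.
  lra.
have /andP[NY YN] : N%:R <= Y < N.+1%:R by apply: truncn_itv; exact: powR_ge0.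
have N0 : (0 < N)%N by have := le_lt_trans Y1 YN; rewrite ltr1n.
have e0 : 0 <= 2 / d%:R :> R by rewrite divr_ge0.
split => //.
  have /andP[+ _] := lamb N; apply: le_trans; rewrite ler_wpM2l ?(ltW e10)//.
  by rewrite -{1}YX; apply: ge0_ler_powR; rewrite ?nnegrE//; lra.
have /andP[_ +] := lamb N.-1; rewrite prednK// => /le_trans; apply.
rewrite ler_wpM2l ?(ltW e20)//.
by rewrite -[leRHS]YX; apply: ge0_ler_powR; rewrite ?nnegrE//; lra.
Qed.

(** Since lam0 <= lam1 and x <= tau <= b, the product of e^(lam0 x) and e^(-b lam1) is at most
    e^(-(b - x) lam1), which decreases in lam1, so e1 X may replace lam1. The isolated [r] is
    absorbed by adding 1 to [kappa * tau]. *)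
Lemma error_at_level (lam0 lam1 e1 e2 X k1 kappa tau x a b rho del : R)
    (r := rho * (lam1 `^ (- a) * expR (- (b * lam1)))) :
  0 < e1 -> 1 <= X -> 0 <= kappa -> 0 <= x <= tau -> 0 <= k1 -> 0 <= a -> tau <= b ->
  0 < rho -> 0 < del ->
  0 <= lam0 -> lam0 <= lam1 -> e1 * X <= lam1 -> lam0 <= e2 * X ->
  expR ((lam0 + k1) * x) * (del + kappa * r * tau) + r <=
  expR (k1 * x) * (expR (e2 * X * x) * del +
    (kappa * tau + 1) * (rho * ((e1 * X) `^ (- a) * expR (- ((b - x) * (e1 * X)))))).
Proof.
move=> e10 X1 kap0 /andP[x0 xt] k10 a0 tb rho0 del0 l00 l01 eX lX.
have X0 : 0 < X by lra.
have eX0 : 0 < e1 * X by rewrite mulr_gt0.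
have r0 : 0 <= r by rewrite /r !mulr_ge0 ?powR_ge0 ?expR_ge0 ?(ltW rho0).
have k1x : 1 <= expR (k1 * x) by rewrite -expR0 ler_expR mulr_ge0.
have l0x : 1 <= expR (lam0 * x) by rewrite -expR0 ler_expR mulr_ge0.
set r' := rho * _.
have lr : expR (lam0 * x) * r <= r'.
  rewrite /r /r' mulrCA ler_wpM2l ?(ltW rho0)// mulrCA -expRD.
  apply: ler_pM; rewrite ?powR_ge0 ?expR_ge0//.
    rewrite !powRN lef_pV2 ?posrE ?powR_gt0//; last by lra.
    by apply: ge0_ler_powR; rewrite ?nnegrE//; lra.
  rewrite ler_expR.
  have h1 : lam0 * x <= lam1 * x by rewrite ler_wpM2r.
  have h2 : (b - x) * (e1 * X) <= (b - x) * lam1 by rewrite ler_wpM2l//; lra.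
  by lra.
rewrite mulrDl expRD [_ * expR (k1 * x)]mulrC -mulrA.
have h1 : expR (lam0 * x) * del <= expR (e2 * X * x) * del.
  by rewrite ler_wpM2r ?(ltW del0)// ler_expR ler_wpM2r.
have kt : 0 <= kappa * tau by rewrite mulr_ge0//; lra.
have h2 : r <= expR (k1 * x) * (expR (lam0 * x) * r).
  apply: (@le_trans _ _ (expR (lam0 * x) * r)).
    by rewrite ler_peMl.
  by rewrite ler_peMl// mulr_ge0// expR_ge0.
have h3 : kappa * tau * (expR (lam0 * x) * r) <= kappa * tau * r' by rewrite ler_wpM2l.
apply: (@le_trans _ _ (expR (k1 * x) * (expR (lam0 * x) * del + (kappa * tau + 1) * (expR (lam0 * x) * r)))).
  rewrite -subr_ge0.
  rewrite (_ : _ - _ = expR (k1 * x) * (expR (lam0 * x) * r) - r); last by ring.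
  by rewrite subr_ge0.
by rewrite ler_wpM2l ?expR_ge0//; lra.
Qed.

Lemma level_bound_calK (e1 e2 tau t p rho del : R) (eta := e1 * t + e2 * (tau - t))
    (y := 1 / eta * ln (rho / del))
    (X := ln ((del / rho) `^ (- 1 / eta) * y `^ (- p / eta)))
    (T := rho `^ (e2 * (tau - t) / eta) * del `^ (e1 * t / eta) *
          y `^ (- p * e2 * (tau - t) / eta)) :
  0 < e1 -> 0 < eta -> 0 < p -> 0 < rho -> 0 < del ->
  del <= rho * expR (- (eta * (2 + (4 * (p / eta)) ^+ 2))) ->
  [/\ 1 <= X, expR (e2 * X * (tau - t)) * del = T &
      rho * ((e1 * X) `^ (- p) * expR (- ((tau - (tau - t)) * (e1 * X)))) <=
      (e1 / 2) `^ (- p) * T].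
Proof.
move=> e10 eta0 p0 rho0 del0 /(ln_ratio_ge rho0 del0) KL.
have eta_neq0 : eta != 0 by rewrite gt_eqF.
have yK : 2 + (4 * (p / eta)) ^+ 2 <= y by rewrite /y div1r [eta^-1 * _]mulrC ler_pdivlMr// [leLHS]mulrC.
have y2 : 2 <= y by have := sqr_ge0 (4 * (p / eta)); lra.
have y0 : 0 < y by lra.
have LE : ln (rho / del) = ln rho - ln del by rewrite ln_div.
have XE : X = (ln rho - ln del) / eta - p / eta * ln y.
  rewrite /X lnM ?posrE ?powR_gt0 ?divr_gt0// !ln_powR ln_div//.
  by field.
have yE : y = (ln rho - ln del) / eta by rewrite /y LE div1r mulrC.
have XY : y / 2 <= X.
  have := @ln_le_half (p / eta) y (divr_gt0 p0 eta0) yK.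
  by rewrite XE -yE; lra.
have X1 : 1 <= X by lra.
split => //.
  rewrite /T !powR_expR// -{1}(lnK del0) -!expRD XE; congr expR.
  by rewrite /eta; field.
apply: (@le_trans _ _ (rho * ((e1 * (y / 2)) `^ (- p) * expR (- ((tau - (tau - t)) * (e1 * X)))))).
  rewrite ler_wpM2l ?(ltW rho0)// ler_wpM2r ?expR_ge0//.
  have le12 : e1 * (y / 2) <= e1 * X by rewrite ler_wpM2l// ltW.
  have e1y : 0 < e1 * (y / 2) by rewrite mulr_gt0// divr_gt0.
  have e1X : 0 < e1 * X := lt_le_trans e1y le12.
  rewrite !powRN lef_pV2 ?posrE ?powR_gt0//.
  by apply: (ge0_ler_powR (ltW p0) _ _ le12); rewrite nnegrE ltW.
have -> : e1 * (y / 2) = e1 / 2 * y by ring.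
have e12 : 0 <= e1 / 2 by rewrite divr_ge0// ltW.
rewrite (powRM _ e12 (ltW y0)); set E := expR _.
rewrite (_ : rho * (_ * _ * E) = (e1 / 2) `^ (- p) * (rho * (y `^ (- p) * E))).
  2: by ring.
rewrite ler_wpM2l ?powR_ge0// /E.
rewrite /T !powR_expR// -{1}(lnK rho0) -!expRD XE le_eqVlt; apply/orP; left.
by apply/eqP; congr expR; rewrite /eta; field.
Qed.

(** For a = 0 there is no polynomial weight to compensate, so the balanced X makes both terms equal
    to [T]. The condition on [del] is X >= 1. *)
Lemma level_bound_calM (e1 e2 tau t q rho del : R) (zeta := e1 * (q + t) + e2 * (tau - t))
    (X := 1 / zeta * ln (rho / del))
    (T := rho `^ (e2 * (tau - t) / zeta) * del `^ (e1 * (q + t) / zeta)) :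
  0 < zeta -> 0 < rho -> 0 < del -> del <= rho * expR (- zeta) ->
  [/\ 1 <= X, expR (e2 * X * (tau - t)) * del = T &
      rho * ((e1 * X) `^ (- 0) * expR (- ((q + tau - (tau - t)) * (e1 * X)))) = T].
Proof.
move=> zeta0 rho0 del0 /(ln_ratio_ge rho0 del0) KL.
have zeta_neq0 : zeta != 0 by rewrite gt_eqF.
have XE : X = (ln rho - ln del) / zeta by rewrite /X ln_div// div1r mulrC.
split.
- by rewrite /X div1r mulrC ler_pdivlMr// mul1r.
- rewrite /T !powR_expR// -{1}(lnK del0) -!expRD XE; congr expR.
  by rewrite /zeta; field.
- rewrite oppr0 powRr0 mul1r /T !powR_expR// -{1}(lnK rho0) -!expRD XE; congr expR.
  by rewrite /zeta; field.
Qed.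

End truncation_level.

Theorem theorem4p5 (R : realType) (d : nat) (d_gt0 : (0 < d)%N)
  (Omega : smooth_domain R d) (tau : R) (tau_gt0 : 0 < tau)
  (lam : nat -> R) (phi : nat -> L2 Omega)
  (lam_phi : dirichlet_eigenbasis lam phi)
  (F : R -> L2 Omega -> L2 Omega)
  (kappa : R) (kappa_gt0 : 0 < kappa)
  (F_lip : forall s, s \in `[0, tau] -> forall psi1 psi2 : L2 Omega,
     norm2 (F s psi1 - F s psi2) <= kappa * norm2 (psi1 - psi2))
  (F_L1 : exists psi : L2 Omega, bochner_integrable `[0, tau] (fun s => F s psi))
  (g : L2 Omega) (u : R -> L2 Omega)
  (u_solution : unique_in_C tau (final_value_solution tau F g) u)
  (u_coef : coefficient_formula tau lam phi F g u)
  (gdelta : R -> L2 Omega)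
  (gdelta_close : forall delta, 0 < delta -> norm2 (gdelta delta - g) <= delta)
  (udelta : R -> nat -> R -> L2 Omega)
  (udelta_solution : forall delta N, 0 < delta -> (0 < N)%N ->
     unique_in_C tau (regularized_solution tau lam phi F N (gdelta delta))
       (udelta delta N))
  (p q rho : R) (p_gt0 : 0 < p) (q_gt0 : 0 < q) (rho_gt0 : 0 < rho)
  (e1 e2 : R) (e1_gt0 : 0 < e1) (e2_gt0 : 0 < e2)
  (lam_bounds : forall j : nat,
     e1 * j.+1%:R `^ (2 / d%:R) <= lam j <= e2 * j.+1%:R `^ (2 / d%:R)) :
  let kappa0 := Num.max kappa 1 in
  let kappa1 := 1 + kappa0 in
  let eta := fun t : R => e1 * t + e2 * (tau - t) in
  let zeta := fun t : R => e1 * (q + t) + e2 * (tau - t) in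
  (calK tau lam phi p rho u ->
    exists2 C : R, 0 < C &
    forall t, t \in `[0, tau] ->
    exists2 delta_t : R, 0 < delta_t &
    forall delta, 0 < delta -> delta <= delta_t ->
    let N_delta := Num.truncn
      ((ln ((delta / rho) `^ (- 1 / eta t) *
            (1 / eta t * ln (rho / delta)) `^ (- p / eta t)))
         `^ (d%:R / 2)) in
    norm2 (u t - udelta delta N_delta t) <=
      C * (expR (kappa1 * (tau - t)) *
           rho `^ (e2 * (tau - t) / eta t) *
           delta `^ (e1 * t / eta t) *
           (1 / eta t * ln (rho / delta)) `^ (- p * e2 * (tau - t) / eta t)))
  /\
  (calM tau lam phi q rho u ->
    exists2 C : R, 0 < C &
    forall t, t \in `[0, tau] ->
    \forall delta \near 0^'+,
    let N_delta := Num.truncn ((1 / zeta t * ln (rho / delta)) `^ (d%:R / 2)) in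
    norm2 (u t - udelta delta N_delta t) <=
      C * (expR (kappa1 * (tau - t)) *
           rho `^ (e2 * (tau - t) / zeta t) *
           delta `^ (e1 * (q + t) / zeta t))).

Proof.
move=> kappa0 kappa1 eta zeta.
have [cu [_ uF _] _] := u_solution.
have l0 j := ltW (eigenvalue_gt0 lam_phi j).
have kk1 : 1 + kappa <= kappa1 by rewrite lerD2l le_max lexx.
have k10 : 0 <= kappa1 by rewrite (le_trans _ kk1)// addr_ge0// ltW.
(* One estimate for both classes: (a, b) is (p, tau) for [calK] and (0, q + tau) for [calM]. *)
have error a b X t delta : 0 <= a -> tau <= b -> 1 <= X -> 0 < delta ->
    t \in `[0, tau] -> (Linfty_gevrey_norm tau lam phi a b u <= rho%:E)%E ->
    norm2 (u t - udelta delta (Num.truncn (X `^ (d%:R / 2))) t) <=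
    expR (kappa1 * (tau - t)) * (expR (e2 * X * (tau - t)) * delta +
      (kappa * tau + 1) *
      (rho * ((e1 * X) `^ (- a) * expR (- ((b - (tau - t)) * (e1 * X)))))).
  move=> a0 tb X1 delta0 tI urho.
  have [N0 N1 N2] := truncn_level d_gt0 e1_gt0 e2_gt0 X1 lam_bounds.
  have [cv v_sol _] := udelta_solution delta _ delta0 N0.
  have b0 : 0 <= b by rewrite (le_trans _ tb)// ltW.
  have tail := @Linfty_gevrey_tail R d Omega lam phi lam_phi tau tau_gt0 a b u rho
    (Num.truncn (X `^ (d%:R / 2))) a0 b0 (ltW rho_gt0) cu urho.
  have r0 := le_trans (norm2_ge0 _) (tail t tI).
  apply: le_trans (regularized_error lam_phi tau_gt0 (ltW kappa_gt0) F_lip N0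
    (ltW delta0) r0 cu cv uF u_coef v_sol (gdelta_close _ delta0) tail kk1 tI) _.
  have /andP[t0 tt] : 0 <= t <= tau by move: tI; rewrite in_itv.
  have xt : 0 <= tau - t <= tau by rewrite subr_ge0 tt gerBl.
  apply: error_at_level => //; first exact: ltW.
  by apply: (eigenvalue_le lam_phi); exact: leq_pred.
have eta0 t : t \in `[0, tau] -> 0 < eta t.
  rewrite in_itv/= => /andP[t0 tt]; rewrite /eta.
  move: t0; rewrite le_eqVlt => /predU1P[<-|t0].
    by rewrite mulr0 add0r subr0 mulr_gt0.
  by rewrite ltr_pwDl ?mulr_gt0// mulr_ge0 ?subr_ge0// ltW.
have kt : 0 <= kappa * tau + 1 by rewrite addr_ge0// mulr_ge0// ltW.
split.
(* In the constant, 1 accounts for the data error and the rest for the tail; it does not depend on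
   [t]. *)
- move=> [_ urho]; exists (1 + (kappa * tau + 1) * (e1 / 2) `^ (- p)).
    by rewrite ltr_wpDr// mulr_ge0// powR_ge0.
  (* Below this threshold y = ln(rho/delta) / eta(t) is at least 2 + (4 p / eta(t))^2, as
     [level_bound_calK] requires. *)
  move=> t tI; exists (rho * expR (- (eta t * (2 + (4 * (p / eta t)) ^+ 2)))).
    by rewrite mulr_gt0// expR_gt0.
  move=> delta delta0 deltat; cbv zeta.
  have [X1 E1 E2] := level_bound_calK e1_gt0 (eta0 t tI) p_gt0 rho_gt0 delta0 deltat.
  apply: le_trans (error p tau _ t delta (ltW p_gt0) (lexx _) X1 delta0 tI urho) _.
  rewrite E1 -!(mulrA (expR _)) [leRHS]mulrCA ler_wpM2l ?expR_ge0//.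
  by rewrite -!/(eta t) [leRHS]mulrDl [X in _ <= X + _]mul1r lerD2l -(mulrA (_ + 1)) ler_wpM2l.
- move=> [_ urho]; exists (1 + (kappa * tau + 1)); first by rewrite ltr_wpDr.
  move=> t tI.
  have zeta0 : 0 < zeta t.
    by rewrite /zeta (mulrDr e1) -addrA ltr_pwDl ?mulr_gt0// ltW// eta0.
  near=> delta; cbv zeta.
  have delta0 : 0 < delta by near: delta; exact: nbhs_right_gt.
  have deltat : delta <= rho * expR (- zeta t).
    by near: delta; apply: nbhs_right_le; rewrite mulr_gt0// expR_gt0.
  have [X1 E1 E2] := level_bound_calM zeta0 rho_gt0 delta0 deltat.
  have tb : tau <= q + tau by rewrite lerDr ltW.
  apply: le_trans (error 0 (q + tau) _ t delta (lexx _) tb X1 delta0 tI urho) _.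
  rewrite E1 E2 -!(mulrA (expR _)) [leRHS]mulrCA ler_wpM2l ?expR_ge0//.
  by rewrite -!/(zeta t) [leRHS]mulrDl [X in _ <= X + _]mul1r.
Unshelve. all: by end_near. Qed.
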